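(* Let $T>0$, $c_0>0$, let $V,g:\mathbb{R}\to\mathbb{R}$ be twice differentiable with $\sup_{z\in\mathbb{R}}(|V'(z)|+|V''(z)|)<\infty$ and $\sup_{z\in\mathbb{R}}(|g'(z)|+|g''(z)|)<\infty$, and let $\rho_0$ be (the density of) a compactly supported probability measure on $\mathbb{R}$ that is absolutely continuous with respect to Lebesgue measure. Let $Q\in L^2(0,T)$. Then $\omega^*\in L^2(0,T)$ is an equilibrium price if and only if $\omega^*$ minimizes over $\omega\in L^2(0,T)$ the functional $$I[\omega]=\int_0^TQ(t)\omega(t)\,dt-\int_{\mathbb{R}}\phi_\omega(x)\rho_0(x)\,dx.$$
   Context: For $\omega\in L^2(0,T)$ and $x\in\mathbb{R}$ define $$\phi_\omega(x)=\inf\left\{\int_0^T\left[\tfrac{c_0}{2}\dot z(t)^2+\dot z(t)\omega(t)+V(z(t))\right]dt+g(z(T))\;:\;z\in H^1(0,T),\ z(0)=x\right\},\qquad(\ast)$$ where $H^1(0,T)$ functions are identified with their continuous representatives on $[0,T]$. Under the stated assumptions on $V,g$, problem $(\ast)$ has a minimizer for every $x$, the minimizer is unique for Lebesgue-a.e. $x$, and one can select minimizers $z^*_\omega(\cdot,x)$ of $(\ast)$, one for each $x\in\mathbb{R}$, so that $(t,x)\mapsto z^*_\omega(t,x)$ is Borel measurable; the optimal trading rate is $\alpha^*_{x,\omega}(t)=\dot z^*_\omega(t,x)$ (derivative in $t$, defined for a.e. $t$). Given a supply $Q\in L^2(0,T)$, a function $\omega^*\in L^2(0,T)$ is called an equilibrium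 price if the market clearing condition holds: $$\int_{\mathbb{R}}\alpha^*_{x,\omega^*}(t)\,\rho_0(x)\,dx=Q(t)\quad\text{for a.e. }t\in(0,T).$$ *)

(* Defs.v *)
From HB Require Import structures.
From mathcomp Require Import all_boot all_order all_algebra.
From mathcomp Require Import all_classical all_reals all_analysis.

Set Implicit Arguments.
Unset Strict Implicit.
Unset Printing Implicit Defensive.

Import Order.TTheory GRing.Theory Num.Theory.
Import numFieldNormedType.Exports.

Local Open Scope classical_set_scope.
Local Open Scope ring_scope.

(* Elements of L^2(0,T) are represented by functions on the whole line; only
   their values on ]0,T[ matter, hence the restriction by zero. *)
Definition L2 (R : realType) (T : R) (f : R -> R) : Prop :=
  f \_ `]0, T[ \in Lfun (@lebesgue_measure R) 2%:E.

Definition test_function (R : realType) (T : R) (psi : R -> R) : Prop :=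
  [/\ forall t, derivable psi t 1,
      continuous (derive1 psi) &
      exists a b : R, [/\ 0 < a, b < T & forall t, t \notin `[a, b] -> psi t = 0]].

(* The test functions are C^1 with compact support in ]0,T[. *)
Definition weak_derivative (R : realType) (T : R) (z v : R -> R) : Prop :=
  forall psi, test_function T psi ->
    \int[lebesgue_measure]_(t in `]0, T[) (z t * derive1 psi t) =
    - \int[lebesgue_measure]_(t in `]0, T[) (v t * psi t).

(* H^1(0,T), each class being identified with its continuous representative on
   [0,T]; membership of z itself in L^2(0,T) follows from continuity. Such a z
   is differentiable almost everywhere and derive1 z is then its weak derivative. *)
Definition H1 (R : realType) (T : R) (z : R -> R) : Prop :=
  {within `[0, T], continuous z} /\
  exists2 v, L2 T v & weak_derivative T z v.

Definition cost (R : realType) (T c0 : R) (V g omega z : R -> R) : R :=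
  \int[lebesgue_measure]_(t in `]0, T[)
    (c0 / 2 * derive1 z t ^+ 2 + derive1 z t * omega t + V (z t)) + g (z T).

Definition admissible (R : realType) (T x : R) : set (R -> R) :=
  [set z | H1 T z /\ z 0 = x].

Definition value (R : realType) (T c0 : R) (V g omega : R -> R) (x : R) : R :=
  inf [set cost T c0 V g omega z | z in admissible T x].

Definition minimizer (R : realType) (T c0 : R) (V g omega : R -> R) (x : R)
    (z : R -> R) : Prop :=
  admissible T x z /\
  forall y, admissible T x y -> cost T c0 V g omega z <= cost T c0 V g omega y.

Definition measurable_selection (R : realType) (T c0 : R) (V g omega : R -> R)
    (z : R -> R -> R) : Prop :=
  (forall x, minimizer T c0 V g omega x (z ^~ x)) /\
  measurable_fun (`[0, T] `*` [set: measurableTypeR R])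
    (fun p : measurableTypeR R * measurableTypeR R => z p.1 p.2 : R).

Definition trading_rate (R : realType) (z : R -> R -> R) (x t : R) : R :=
  derive1 (z ^~ x) t.

Definition market_clearing (R : realType) (T : R) (rho0 Q : R -> R)
    (z : R -> R -> R) : Prop :=
  {ae @lebesgue_measure R, forall t, t \in `]0, T[ ->
    \int[lebesgue_measure]_x (trading_rate z x t * rho0 x) = Q t}.

(* Minimizers are unique for almost every x and rho0 is a density, so market
   clearing does not depend on which measurable selection is used. *)
Definition equilibrium_price (R : realType) (T c0 : R) (V g rho0 Q : R -> R)
    (omega : R -> R) : Prop :=
  L2 T omega /\
  exists2 z, measurable_selection T c0 V g omega z &
    market_clearing T rho0 Q z.

Definition dual_functional (R : realType) (T c0 : R) (V g rho0 Q : R -> R)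
    (omega : R -> R) : R :=
  \int[lebesgue_measure]_(t in `]0, T[) (Q t * omega t) -
  \int[lebesgue_measure]_x (value T c0 V g omega x * rho0 x).

Definition minimizes_over_L2 (R : realType) (T : R) (I : (R -> R) -> R)
    (omega : R -> R) : Prop :=
  L2 T omega /\ forall eta, L2 T eta -> I omega <= I eta.

Definition bounded_derivatives (R : realType) (f : R -> R) : Prop :=
  [/\ forall z, derivable f z 1,
      forall z, derivable (derive1 f) z 1 &
      has_ubound (range (fun z => `|derive1 f z| + `|derive1 (derive1 f) z|))].

Definition probability_density (R : realType) (rho : R -> R) : Prop :=
  [/\ measurable_fun setT rho, forall x, 0 <= rho x &
      (\int[lebesgue_measure]_x (rho x)%:E = 1)%E].

(* The measure with density rho is carried by a compact set. *)
Definition compactly_supported (R : realType) (rho : R -> R) : Prop :=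
  exists2 K : set R, compact K &
    {ae @lebesgue_measure R, forall x, ~ K x -> rho x = 0}.

(* Main.v *)
(* Writing z(t) = x + P v (t) with P v the primitive of v, the cost becomes a
   functional J w x v on L^2.  Its gradient in v is the residual c0 v + w - p,
   where the momentum p(t) = - g'(z(T)) - (the integral of V'(z) over [t,T]) is
   bounded and Lipschitz.  A gradient step shows that the residual of an
   approximate minimizer is small in L^2; by Gronwall's inequality two such
   trajectories are then close as soon as their starting points and initial
   momenta are.  Compactness of the bounded interval of initial momenta p(0)
   thus yields minimizers, without weak convergence.  Semiconcavity of the value
   phi makes p(0) + C x nondecreasing in x for any choice of minimizers, so that
   every such choice is measurable and p(0) is unique for almost every x.
   Minimizers satisfy c0 v = p - w, hence clearing means that the mean of p is
   c0 Q + w.  If it holds, testing phi_eta with the minimizers for w and using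
   Fubini gives I[w] <= I[eta].  Conversely, compare w with w + s eta: the
   momenta converge for almost every x as s -> 0+, and minimality of w gives
   int eta (mean p - c0 Q - w) <= 0; take eta = mean p - c0 Q - w. *)

Require Import Defs.
From HB Require Import structures.
From mathcomp Require Import all_boot all_order all_algebra.
From mathcomp Require Import all_classical all_reals all_analysis.
From mathcomp Require Import measurable_realfun ring lra.

Import Order.TTheory GRing.Theory Num.Theory.
Import numFieldNormedType.Exports.

Local Open Scope classical_set_scope.
Local Open Scope ring_scope.

Set Implicit Arguments.
Unset Strict Implicit.
Unset Printing Implicit Defensive.

(** V and g need not be convex, so minimizers may be non-unique and neither trajectories nor momenta
    need be continuous in x or in the price. Convexity is replaced by the quadratic upper bound
    [J_expand]: the second derivatives are bounded, hence the cost lies below its linearization plus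
    a quadratic term. Moving only the starting point yields semiconcavity of the value, changing
    only the velocity yields the gradient step.

    On the dual side the cost is affine in the price, so phi, an infimum, is concave in it. The mean
    velocity of the minimizers is a supergradient of the averaged value, and clearing says that this
    supergradient is Q. The converse rests on the uniqueness of p(0) at almost every x.

    Velocities are known only up to null sets of times that could depend on x, whereas clearing is
    stated at a fixed time. The momentum is continuous in t and, along a family of minimizers,
    measurable in (x, t), so all averages are taken of momenta. The pointwise derivative of a
    minimizer is then recovered wherever the primitive of the price has derivative w, a condition
    that does not involve x. *)

Ltac meas := repeat first
  [ assumption | exact: measurable_cst | exact: measurable_id | exact: normr_measurable
  | apply: measurable_funX | apply: measurable_funB | apply: measurable_funD
  | apply: measurable_funM | apply: measurable_funN
  | apply: (measurableT_comp (f := Num.norm)) ].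

(** * Continuity of combinations of real functions *)

Section real_continuity.
Variable R : realType.
Implicit Types f g : R -> R.

Lemma contD f g : continuous f -> continuous g -> continuous (fun t => f t + g t).
Proof. by move=> cf cg t; apply: cvgD; [exact: cf|exact: cg]. Qed.

Lemma contB f g : continuous f -> continuous g -> continuous (fun t => f t - g t).
Proof. by move=> cf cg t; apply: cvgB; [exact: cf|exact: cg]. Qed.

Lemma contM f g : continuous f -> continuous g -> continuous (fun t => f t * g t).
Proof. by move=> cf cg t; apply: cvgM; [exact: cf|exact: cg]. Qed.

Lemma contZ r f : continuous f -> continuous (fun t => r * f t).
Proof. by move=> cf; apply: contM => // t; exact: cst_continuous. Qed.

Lemma contX f n : continuous f -> continuous (fun t => f t ^+ n).
Proof.
move=> cf; elim: n => [|n ih]; first by move=> t; exact: cst_continuous.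
by under eq_fun do rewrite exprS; exact: contM.
Qed.

Lemma contMax f g : continuous f -> continuous g -> continuous (fun t => Num.max (f t) (g t)).
Proof. by move=> cf cg t; exact: (continuous_max (cf t) (cg t)). Qed.

Lemma contMin f g : continuous f -> continuous g -> continuous (fun t => Num.min (f t) (g t)).
Proof. by move=> cf cg t; exact: (continuous_min (cf t) (cg t)). Qed.

End real_continuity.

(** * Integrals of functions that need not be measurable *)

Section integral_nonmeasurable.
Context d (X : measurableType d) (R : realType).
Variable mu : {measure set X -> \bar R}.

Import HBNNSimple.

(** The integral of a nonnegative function is a supremum over simple functions below it, measurable
    or not. A simple function below f is almost everywhere below g. Conversely, g set to zero on the
    exceptional null set keeps its integral and lies below f everywhere. *)
Let ge0_ae_eq_integralT (f g : X -> \bar R) :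
  (forall x, 0 <= f x)%E -> (forall x, 0 <= g x)%E ->
  measurable_fun setT g -> {ae mu, forall x, f x = g x} ->
  (\int[mu]_x f x = \int[mu]_x g x)%E.
Proof.
move=> f0 g0 mg fg; apply/eqP; rewrite eq_le; apply/andP; split.
  rewrite ge0_integralTE//; apply: ge_ereal_sup => _ /= [h hf <-].
  rewrite -integralT_nnsfun; apply: ae_ge0_le_integral => //=.
  - by move=> x _; rewrite lee_fin; exact: fun_ge0.
  - exact/measurable_EFinP.
  - case: fg => N [mN N0 fgN]; exists N; split => // x /= hN.
    by apply: fgN => /= e; apply: hN => _; rewrite -e; exact: hf.
case: fg => N [mN N0 fgN].
have mgN : measurable_fun setT (g \_ (~` N)).
  apply/measurable_restrict => //; first exact: measurableC.
  by rewrite setTI; exact: measurable_funTS.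
rewrite (@ae_eq_integral _ _ _ mu setT (g \_ (~` N)) g) //; last first.
  exists N; split => // x /= hN; apply: contrapT => Nx; apply: hN => _.
  by rewrite patchE mem_set.
rewrite !ge0_integralTE//; last first.
  by move=> x; rewrite patchE; case: ifPn.
apply: le_ereal_sup => _ /= [h hg <-]; exists h => // x.
apply: (le_trans (hg x)); rewrite patchE; case: ifPn => // /set_mem /= Nx.
suff -> : f x = g x by [].
by apply: contrapT => ne; apply: Nx; apply: fgN.
Qed.

(* Unlike in [ae_eq_integral], [f] need not be measurable: as the Borel
   sigma-algebra is not complete, a derivative that agrees almost everywhere
   with a measurable function need not be. *)
Lemma ae_eq_Rintegral (A : set X) (f g : X -> R) :
  measurable A -> measurable_fun A g -> {ae mu, forall x, A x -> f x = g x} ->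
  \int[mu]_(x in A) f x = \int[mu]_(x in A) g x.
Proof.
move=> mA mg fg; rewrite Rintegral_mkcond [RHS]Rintegral_mkcond /Rintegral; congr fine.
rewrite integralE [RHS]integralE.
have mg' : measurable_fun setT (g \_ A) by apply/(measurable_restrictT _ _).1.
have fg' : {ae mu, forall x, (f \_ A) x = (g \_ A) x}.
  apply: filterS fg => x fg; rewrite !patchE; case: ifPn => // /set_mem.
  exact: fg.
congr (_ - _)%E; apply: ge0_ae_eq_integralT => //.
- exact/measurable_funepos/measurable_EFinP.
- by apply: filterS fg' => x fg'; rewrite !funeposE fg'.
- exact/measurable_funeneg/measurable_EFinP.
- by apply: filterS fg' => x fg'; rewrite !funenegE fg'.
Qed.

End integral_nonmeasurable.

Lemma ae_imp d (X : measurableType d) (R : realType) (mu : {measure set X -> \bar R})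
    (P Q : X -> Prop) :
  (forall x, P x -> Q x) -> {ae mu, forall x, P x} -> {ae mu, forall x, Q x}.
Proof. by move=> PQ; apply: negligibleS => x /= nQ /PQ. Qed.

Lemma aeI d (X : measurableType d) (R : realType) (mu : {measure set X -> \bar R})
    (P Q : X -> Prop) :
  {ae mu, forall x, P x} -> {ae mu, forall x, Q x} -> {ae mu, forall x, P x /\ Q x}.
Proof.
move=> hP hQ; have := negligibleU hP hQ; apply: negligibleS => x /= nPQ.
by have [Px|nPx] := pselect (P x); [right => Qx; exact: nPQ|left].
Qed.

(** * Integrable and square-integrable functions on ]0,T[ *)

Section integral_oo.
Variables (R : realType) (T : R).
Hypothesis T0 : 0 < T.
Local Notation mu := (@lebesgue_measure R).
Local Notation D := (`]0, T[%classic : set (measurableTypeR R)).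
Local Notation Int := (Rintegral mu D).
Implicit Types f g h v w : R -> R.

Definition integrable_oo (f : R -> R) : Prop := mu.-integrable D (EFin \o f).
Local Notation L1 := integrable_oo.

Lemma integrable_oo_measurable f : L1 f -> measurable_fun D f.
Proof. by move=> /integrableP[/measurable_EFinP]. Qed.

Lemma L1D f g : L1 f -> L1 g -> L1 (fun t => f t + g t).
Proof. by move=> hf hg; exact: (integrableD _ hf hg). Qed.

Lemma L1B f g : L1 f -> L1 g -> L1 (fun t => f t - g t).
Proof. by move=> hf hg; exact: (integrableB _ hf hg). Qed.

Lemma L1Z r f : L1 f -> L1 (fun t => r * f t).
Proof. by move=> hf; exact: (integrableZl _ r hf). Qed.

Lemma L1_le f g : measurable_fun D f -> L1 g ->
  (forall t, D t -> `|f t| <= `|g t|) -> L1 f.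
Proof.
move=> mf hg fg; apply: le_integrable hg => //; first exact/measurable_EFinP.
Qed.

Lemma mu_D : mu D = T%:E.
Proof.
by rewrite lebesgue_measure_itv/= lte_fin T0 sube0.
Qed.

Lemma L1_cst r : L1 (fun=> r).
Proof.
apply: measurable_bounded_integrable => //; first by rewrite [X in (X < _)%E]mu_D ltry.
exact: bounded_cst.
Qed.

Lemma L1_bounded f M : measurable_fun D f -> (forall t, D t -> `|f t| <= M) -> L1 f.
Proof.
move=> mf fM; apply: (L1_le (g := fun=> M)) => //; first exact: L1_cst.
by move=> t /fM h; rewrite (le_trans h)// ler_norm.
Qed.

Lemma L1_norm f : L1 f -> L1 (fun t => `|f t|).
Proof. by move=> hf; apply: integrable_norm. Qed.

Lemma L1_mul_bounded f g M : L1 f -> measurable_fun D g ->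
  (forall t, D t -> `|g t| <= M) -> L1 (fun t => f t * g t).
Proof.
move=> hf mg gM; apply: (L1_le (g := fun t => M * f t)).
- by have := integrable_oo_measurable hf => mf; meas.
- exact: L1Z.
- move=> t Dt; rewrite !normrM mulrC ler_wpM2r// (le_trans (gM t Dt))//.
  exact: ler_norm.
Qed.

Lemma IntD f g : L1 f -> L1 g -> Int (fun t => f t + g t) = Int f + Int g.
Proof. by move=> hf hg; rewrite RintegralD. Qed.

Lemma IntB f g : L1 f -> L1 g -> Int (fun t => f t - g t) = Int f - Int g.
Proof. by move=> hf hg; rewrite RintegralB. Qed.

Lemma IntZ r f : L1 f -> Int (fun t => r * f t) = r * Int f.
Proof. by move=> hf; rewrite RintegralZl. Qed.

Lemma Int_cst r : Int (fun=> r) = r * T.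
Proof. by rewrite Rintegral_cst//= mu_D. Qed.

Lemma Int_le f g : L1 f -> L1 g -> (forall t, D t -> f t <= g t) -> Int f <= Int g.
Proof. by move=> hf hg fg; apply: le_Rintegral. Qed.

Lemma Int_ge0 f : (forall t, D t -> 0 <= f t) -> 0 <= Int f.
Proof. by move=> h; apply: Rintegral_ge0. Qed.

Lemma Int_norm f : L1 f -> `|Int f| <= Int (fun t => `|f t|).
Proof. by move=> hf; apply: le_normr_Rintegral. Qed.

Lemma eq_Int f g : (forall t, D t -> f t = g t) -> Int f = Int g.
Proof. by move=> fg; apply: eq_Rintegral => t /set_mem; exact: fg. Qed.

Lemma L1_eq f g : L1 f -> (forall t, D t -> f t = g t) -> L1 g.
Proof.
move=> hf fg; apply: eq_integrable hf => // t /set_mem Dt /=; by rewrite fg.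
Qed.

Lemma Int_norm_le f g : L1 f -> L1 g -> (forall t, D t -> `|f t| <= g t) ->
  `|Int f| <= Int g.
Proof.
move=> hf hg fg; apply: (le_trans (Int_norm hf)).
by apply: Int_le => //; exact: L1_norm.
Qed.

(** The working form of [L2], free of the restriction by zero; [S2_L2] gives the equivalence. *)
Definition square_integrable (f : R -> R) : Prop :=
  measurable_fun D f /\ L1 (fun t => f t ^+ 2).
Local Notation S2 := square_integrable.

Lemma S2_mul f g : S2 f -> S2 g -> L1 (fun t => f t * g t).
Proof.
move=> [mf hf] [mg hg].
apply: (L1_le (g := fun t => f t ^+ 2 + g t ^+ 2)); first by meas.
  exact: L1D.
move=> t _; rewrite (@ger0_norm _ (_ + _)) ?addr_ge0 ?sqr_ge0//.
rewrite normrM -(real_normK (num_real (f t))) -(real_normK (num_real (g t))).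
have := sqr_ge0 (`|f t| - `|g t|); have := sqr_ge0 (`|f t| + `|g t|).
nra.
Qed.

Lemma S2_bounded f M : measurable_fun D f -> (forall t, D t -> `|f t| <= M) -> S2 f.
Proof.
move=> mf fM; split => //; apply: (L1_bounded (M := M ^+ 2)); first by meas.
by move=> t Dt; rewrite normrX ler_pXn2r ?nnegrE//; [exact: fM|exact: le_trans (fM t Dt)].
Qed.

Lemma S2_L1 f : S2 f -> L1 f.
Proof.
move=> hf; have h1 : S2 (fun=> 1) by apply: (S2_bounded (M := 1)) => //; rewrite normr1.
by apply: (L1_eq (S2_mul hf h1)) => t _; rewrite mulr1.
Qed.

Lemma S2Z r f : S2 f -> S2 (fun t => r * f t).
Proof.
move=> [mf hf]; split; first by meas.
by apply: (L1_eq (L1Z (r ^+ 2) hf)) => t _; rewrite exprMn.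
Qed.

Lemma S2D f g : S2 f -> S2 g -> S2 (fun t => f t + g t).
Proof.
move=> hf hg; have hfg := S2_mul hf hg; case: hf hg => [mf hf] [mg hg].
split; first by meas.
apply: (L1_eq (L1D (L1D hf (L1Z 2 hfg)) hg)) => t _.
by ring.
Qed.

Lemma S2B f g : S2 f -> S2 g -> S2 (fun t => f t - g t).
Proof.
move=> hf hg; have [_ h] := S2D hf (S2Z (-1) hg).
split; first by case: hf hg => [mf _] [mg _]; meas.
by apply: (L1_eq h) => t _; rewrite mulN1r.
Qed.

Lemma Int_sqr_eq0 f : S2 f -> Int (fun t => f t ^+ 2) = 0 ->
  {ae mu, forall t, D t -> f t = 0}.
Proof.
move=> [mf hf] h0.
have mf2 : measurable_fun D (EFin \o (fun t => f t ^+ 2)).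
  by apply/measurable_EFinP; meas.
have h1 : (\int[mu]_(t in D) `|(f t ^+ 2)%:E| = 0)%E.
  under eq_integral => t _ do rewrite abse_EFin ger0_norm ?sqr_ge0//.
  have : (\int[mu]_(t in D) (f t ^+ 2)%:E)%E \is a fin_num by exact: integrable_fin_num.
  by move=> /fineK <-; rewrite -/(Rintegral mu D (fun t => f t ^+ 2)) h0.
have /(ae_eq_integral_abs _ _ mf2) := h1.
move=> /(_ (measurable_itv _)) [N [mN N0 hN]]; exists N; split => // t /= ht.
apply: hN => /= hN; apply: ht => Dt; have := hN Dt.
by move=> [/eqP]; rewrite sqrf_eq0 => /eqP.
Qed.

Lemma S2_L2 f : L2 T f <-> S2 f.
Proof.
rewrite /L2; split.
- move=> h; have := Lfun2_integrable_sqr h; move: h.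
  rewrite inE => /andP[]; rewrite inE => /= mf _ hi; split.
    by apply/measurable_restrictT.
  apply/integrable_mkcond => //; apply: eq_integrable hi => // t _ /=.
  by rewrite !patchE; case: ifPn => //=; rewrite expr0n.
- move=> [mf /integrable_mkcond hi].
  have mf' : measurable_fun setT (f \_ `]0, T[).
    by apply/(measurable_restrictT _ _).1.
  rewrite inE; apply/andP; split; rewrite inE //=.
  rewrite /finite_norm unlock /=.
  have : (mu.-integrable setT (fun x => (`|(f \_ `]0, T[) x| `^ 2)%:E))%E.
    apply: eq_integrable (hi _) => // t _ /=.
    rewrite !patchE; case: ifPn => /= _; last by rewrite normr0 powR0.
    by rewrite powR_mulrn// real_normK// num_real.
  move=> /integrableP[_].
  move=> lt; apply: poweR_lty; apply: le_lt_trans lt.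
  rewrite le_eqVlt; apply/orP; left; apply/eqP.
  apply: eq_integral => t _ /=.
  by rewrite [in RHS]ger0_norm// powR_ge0.
Qed.

End integral_oo.

(** * Fubini's theorem, primitives and Gronwall's inequality *)

Section fubini.
Variable R : realType.
Local Notation mu := (@lebesgue_measure R).
Local Notation RR := (measurableTypeR R).
Implicit Types f g : R -> R.

Lemma measurable_ler_nat d (X : measurableType d) (a b : X -> R) :
  measurable_fun setT a -> measurable_fun setT b ->
  measurable_fun setT (fun x => (a x <= b x)%R%:R : R).
Proof.
move=> ma mb.
rewrite (_ : (fun x => _) = (fun x => if a x <= b x then 1 else 0)); last first.
  by apply/funext => x; case: (_ <= _).
by apply: measurable_fun_ifT => //; exact: measurable_fun_ler.
Qed.

Variables (f g : R -> R) (K : RR * RR -> R) (M : R).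
Hypotheses (hf : mu.-integrable setT (EFin \o f)) (hg : mu.-integrable setT (EFin \o g)).
Hypotheses (mK : measurable_fun setT K) (KM : forall p, `|K p| <= M).

Let mf : measurable_fun setT f. Proof. by case/integrableP : hf => /measurable_EFinP. Qed.
Let mg : measurable_fun setT g. Proof. by case/integrableP : hg => /measurable_EFinP. Qed.
Let M0 : 0 <= M. Proof. exact: le_trans (KM (0, 0)). Qed.

Let F (p : RR * RR) := (f p.1 * (g p.2 * K p))%:E.

Let mF : measurable_fun setT F.
Proof.
apply/measurable_EFinP; apply: measurable_funM.
  exact: (measurableT_comp mf measurable_fst).
apply: measurable_funM => //.
exact: (measurableT_comp mg measurable_snd).
Qed.

Let Kg_int s : mu.-integrable setT (EFin \o (fun t => g t * K (s, t))).
Proof.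
apply: (@le_integrable _ _ _ mu setT _ _ (EFin \o (fun t => M * g t))) => //.
- apply/measurable_EFinP; apply: measurable_funM => //.
  exact: (measurable_fun_pair2 s mK).
- move=> t _ /=; rewrite lee_fin !normrM mulrC ler_wpM2r//.
  by rewrite (le_trans (KM _))// ler_norm.
- exact: (integrableZl _ M hg).
Qed.

Let Kf_int t : mu.-integrable setT (EFin \o (fun s => f s * K (s, t))).
Proof.
apply: (@le_integrable _ _ _ mu setT _ _ (EFin \o (fun t => M * f t))) => //.
- apply/measurable_EFinP; apply: measurable_funM => //.
  exact: (measurable_fun_pair1 t mK).
- move=> s _ /=; rewrite lee_fin !normrM mulrC ler_wpM2r//.
  by rewrite (le_trans (KM _))// ler_norm.
- exact: (integrableZl _ M hf).
Qed.

Let F_int : (mu \x mu)%E.-integrable setT F.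
Proof.
apply/(integrable12ltyP _ _ mF) => /=.
have hg' : (\int[mu]_t (`|g t|)%:E)%E = (\int[mu]_t `|g t|)%:E.
  by rewrite /Rintegral fineK//; apply: integrable_fin_num => //; exact: integrable_norm.
have hf' : mu.-integrable setT (EFin \o (fun s => (M * \int[mu]_t `|g t|) * `|f s|)).
  exact: (integrableZl _ _ (integrable_norm hf)).
apply: (@le_lt_trans _ _ (\int[mu]_s ((M * \int[mu]_t `|g t|) * `|f s|)%:E)%E); last first.
  by case/integrableP : (hf') => _; under eq_integral => s _ do
    rewrite /= ger0_norm ?mulr_ge0 ?Rintegral_ge0//.
apply: ge0_le_integral => //=.
- by move=> s _; apply: integral_ge0.
- apply: (@measurable_fun_fubini_tonelli_F _ _ _ _ _ mu (abse \o F)) => //=.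
  exact: measurableT_comp.
- by case/integrableP : hf'.
move=> s _; rewrite /F/=.
apply: (@le_trans _ _ (\int[mu]_t ((`|f s| * M)%:E * (`|g t|)%:E))%E).
  apply: ge0_le_integral => //=.
  - apply/(@measurable_EFinP _ _ _ _ (fun y => `|f s * (g y * K (s, y))|)).
    have mKs := measurable_fun_pair2 s mK.
    apply: measurableT_comp => //; apply: measurable_funM => //.
    exact: measurable_funM.
  - apply: emeasurable_funM => //; apply/measurable_EFinP; exact: measurableT_comp.
  - move=> t _; rewrite -EFinM lee_fin !normrM -mulrA ler_wpM2l//.
    by rewrite mulrC ler_wpM2r.
rewrite integralZl//; last exact: integrable_norm.
by rewrite hg' -EFinM lee_fin mulrC mulrA [_ * M]mulrC mulrA.
Qed.

Lemma kernel_integrable :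
  mu.-integrable setT (EFin \o (fun s => f s * \int[mu]_t (g t * K (s, t)))).
Proof.
have := @integrable_fubini_F _ _ _ _ _ mu mu F F_int.
apply: eq_integrable => // s _ /=; rewrite /fubini_F /F /=.
under eq_integral do rewrite EFinM.
rewrite integralZl//; last exact: Kg_int.
by rewrite EFinM /Rintegral fineK//; apply: integrable_fin_num => //; exact: Kg_int.
Qed.

(** Serves two kernels: the indicator of s <= t, which gives integration by parts, and the momentum
    of agent x at time t, which lets the average over agents pass under the time integral. *)
Lemma Rfubini_kernel :
  \int[mu]_s (f s * \int[mu]_t (g t * K (s, t))) =
  \int[mu]_t (g t * \int[mu]_s (f s * K (s, t))).
Proof.
have E1 s : ((f s * \int[mu]_t (g t * K (s, t)))%:E = \int[mu]_t F (s, t))%E.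
  rewrite /F /=; under [RHS]eq_integral do rewrite EFinM.
  rewrite integralZl//; last exact: Kg_int.
  by rewrite EFinM /Rintegral fineK//; apply: integrable_fin_num => //; exact: Kg_int.
have E2 t : ((g t * \int[mu]_s (f s * K (s, t)))%:E = \int[mu]_s F (s, t))%E.
  rewrite /F /=; under [RHS]eq_integral do rewrite mulrCA EFinM.
  rewrite integralZl//; last exact: Kf_int.
  by rewrite EFinM /Rintegral fineK//; apply: integrable_fin_num => //; exact: Kf_int.
rewrite /Rintegral; apply: (f_equal fine).
under eq_integral do rewrite E1.
under [RHS]eq_integral do rewrite E2.
exact: (@Fubini _ _ _ _ _ mu mu F F_int).
Qed.

End fubini.

Section primitive.
Variables (R : realType) (T : R).
Hypothesis T0 : 0 < T.
Local Notation mu := (@lebesgue_measure R).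
Local Notation D := (`]0, T[%classic : set (measurableTypeR R)).
Local Notation Int := (Rintegral mu D).
Local Notation L1 := (integrable_oo T).
Local Notation S2 := (square_integrable T).
Implicit Types f g h v w : R -> R.

(** The indicator keeps the domain of integration fixed, so that Fubini's theorem applies directly
    and the primitive is defined on the whole line, constant on either side of ]0,T[. *)
Definition prim f (t : R) : R := Int (fun s => f s * (s <= t)%R%:R).

Let mle t : measurable_fun D (fun s : R => (s <= t)%R%:R : R).
Proof. by apply: measurable_funTS; apply: measurable_ler_nat. Qed.

Lemma L1_cut f t : L1 f -> L1 (fun s => f s * (s <= t)%R%:R).
Proof.
move=> hf; apply: (L1_mul_bounded (M := 1)) => // s _.
by case: (s <= t)%R; rewrite ?normr1 ?normr0.
Qed.

Lemma primD f g t : L1 f -> L1 g -> prim (fun s => f s + g s) t = prim f t + prim g t.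
Proof.
move=> hf hg; rewrite /prim -IntD; [|exact: L1_cut..].
by apply: eq_Int => s _; rewrite mulrDl.
Qed.

Lemma primB f g t : L1 f -> L1 g -> prim (fun s => f s - g s) t = prim f t - prim g t.
Proof.
move=> hf hg; rewrite /prim -IntB; [|exact: L1_cut..].
by apply: eq_Int => s _; rewrite mulrBl.
Qed.

Lemma primZ r f t : L1 f -> prim (fun s => r * f s) t = r * prim f t.
Proof.
move=> hf; rewrite /prim -IntZ; last exact: L1_cut.
by apply: eq_Int => s _; rewrite mulrA.
Qed.

Lemma prim_le0 f t : t <= 0 -> prim f t = 0.
Proof.
move=> t0; rewrite /prim (@eq_Int _ _ _ (fun=> 0)); first by rewrite Int_cst// mul0r.
move=> s; rewrite /= in_itv/= => /andP[s0 _].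
by rewrite leNgt (le_lt_trans t0 s0)/= mulr0.
Qed.

Lemma prim_geT f t : T <= t -> prim f t = Int f.
Proof.
move=> Tt; apply: eq_Int => s; rewrite /= in_itv/= => /andP[_ sT].
by rewrite (ltW (lt_le_trans sT Tt)) mulr1.
Qed.

Lemma prim_le f g t : L1 f -> L1 g -> (forall s, D s -> s <= t -> f s <= g s) ->
  prim f t <= prim g t.
Proof.
move=> hf hg fg; apply: Int_le; [exact: L1_cut..|].
by move=> s Ds; case: (leP s t) => st; rewrite ?mulr1 ?mulr0//; exact: fg.
Qed.

Lemma prim_norm f t : L1 f -> `|prim f t| <= prim (fun s => `|f s|) t.
Proof.
move=> hf; apply: Int_norm_le; [exact: L1_cut|apply: L1_cut; exact: L1_norm|].
by move=> s _; case: (s <= t)%R; rewrite ?mulr1 ?mulr0 ?normr0.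
Qed.

Lemma prim_norm_le f t : L1 f -> `|prim f t| <= Int (fun s => `|f s|).
Proof.
move=> hf; rewrite (le_trans (prim_norm _ hf))//.
apply: Int_le => //; [apply: L1_cut|..]; try exact: L1_norm.
by move=> s _; case: (s <= t)%R; rewrite ?mulr1 ?mulr0.
Qed.

(* The variance of [f] on ]0,T[ is nonnegative. *)
Lemma Int_sqr_le f : S2 f -> Int f ^+ 2 <= T * Int (fun s => f s ^+ 2).
Proof.
move=> hf; have h1 := S2_L1 T0 hf; have [_ h2] := hf.
set m := Int f.
have : 0 <= Int (fun s => T * f s ^+ 2 + (m ^+ 2 / T - 2 * m * f s)).
  apply: Int_ge0 => s _.
  have -> : T * f s ^+ 2 + (m ^+ 2 / T - 2 * m * f s) = (T * f s - m) ^+ 2 / T.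
    by field; rewrite gt_eqF.
  by rewrite divr_ge0 ?sqr_ge0 ?ltW.
have hc := L1_cst T0 (m ^+ 2 / T).
rewrite IntD//; [|exact: L1Z|by apply: L1B => //; exact: L1Z].
rewrite IntB//; last exact: L1Z.
rewrite Int_cst// !IntZ// divfK ?gt_eqF// -/m.
lra.
Qed.

Lemma S2_cut f t : S2 f -> S2 (fun s => f s * (s <= t)%R%:R).
Proof.
move=> [mf hf]; split; first by have := mle t => mt; meas.
apply: (L1_eq (L1_cut t hf)) => s _.
by case: (s <= t)%R; rewrite ?mulr1 ?mulr0 ?expr0n.
Qed.

Lemma prim_sqr_le f t : S2 f -> prim f t ^+ 2 <= T * Int (fun s => f s ^+ 2).
Proof.
move=> hf; apply: le_trans (Int_sqr_le (S2_cut t hf)) _; apply: ler_wpM2l; first exact: ltW.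
apply: Int_le; [by case: (S2_cut t hf)|by case: hf|].
by move=> s _; case: (s <= t)%R; rewrite ?mulr1 ?mulr0// expr0n/= sqr_ge0.
Qed.

Lemma L1_restrict f : L1 f -> mu.-integrable setT (EFin \o (f \_ D)).
Proof.
move=> /integrable_mkcond => hf; apply: eq_integrable (hf _) => // s _ /=.
by rewrite !patchE; case: ifPn.
Qed.

Lemma Int_mkcond f : Int f = \int[mu]_s (f \_ D) s.
Proof. exact: Rintegral_mkcond. Qed.

Lemma restrictM f g : (fun s => (f \_ D) s * g s) = (fun s => f s * g s) \_ D.
Proof. by apply/funext => s; rewrite !patchE; case: ifPn; rewrite ?mul0r. Qed.

Lemma Int_restrictM f g : \int[mu]_s ((f \_ D) s * g s) = Int (fun s => f s * g s).
Proof. by rewrite Int_mkcond restrictM. Qed.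

Lemma Int_by_parts f g : L1 f -> L1 g ->
  Int (fun t => g t * prim f t) = Int (fun s => f s * (Int g - prim g s)).
Proof.
move=> hf hg.
have := @Rfubini_kernel R _ _ (fun p => (p.1 <= p.2)%R%:R) 1 (L1_restrict hf) (L1_restrict hg).
move=> /(_ _ _) E; rewrite -[LHS]Int_restrictM -[RHS]Int_restrictM.
have {}E := E (measurable_ler_nat measurable_fst measurable_snd).
rewrite (_ : \int[mu]_s ((g \_ D) s * _) =
  \int[mu]_t ((g \_ D) t * \int[mu]_s ((f \_ D) s * (s <= t)%R%:R))); last first.
  by apply: eq_Rintegral => t _; rewrite /prim -Int_restrictM.
rewrite -E; last by move=> p; case: (p.1 <= p.2)%R; rewrite ?normr1 ?normr0.
apply: eq_Rintegral => s _; congr (_ * _); rewrite Int_restrictM /=.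
have hlt : L1 (fun t => g t * (s < t)%R%:R).
  apply: (L1_eq (L1B hg (L1_cut s hg))) => t _.
  by case: (ltP s t); rewrite ?mulr1 ?mulr0 ?subr0 ?subrr.
have -> : Int g = prim g s + Int (fun t => g t * (s < t)%R%:R).
  rewrite /prim -IntD; [|exact: L1_cut|exact: hlt].
  by apply: eq_Int => t _; case: (ltP s t); rewrite ?mulr1 ?mulr0 ?addr0 ?add0r.
(* Fubini leaves the indicator of s <= t, while the complement of the primitive has s < t; the two
   differ only on the null set {s}. *)
transitivity (Int (fun t => g t * (s < t)%R%:R)); last by ring.
apply: ae_eq_Rintegral; [exact: measurable_itv|exact: integrable_oo_measurable hlt|].
exists [set s]; split; [exact: measurable_set1|exact: lebesgue_measure_set1|].
move=> t /= h; apply: contrapT => ts; apply: h => _.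
by rewrite lt_neqAle; have -> : s != t by apply/eqP => /esym.
Qed.

Lemma primE_itv f (a x : R) : a <= 0 ->
  prim f x = \int[mu]_(s in `[a, x]) (f \_ D) s.
Proof.
move=> a0; rewrite /prim Rintegral_mkcond [RHS]Rintegral_mkcond.
apply: eq_Rintegral => s _; rewrite !patchE.
case: ifPn => [/set_mem /=|_]; last by case: ifP.
rewrite in_itv/= => /andP[s0 _]; have [sx|sx] := leP s x.
  by rewrite mem_set ?mulr1//= in_itv/= sx (le_trans a0 (ltW s0)).
by rewrite memNset ?mulr0//= in_itv/= (leNgt s x) sx andbF.
Qed.

Lemma primE_Nyitv f (x : R) : prim f x = \int[mu]_(s in `]-oo, x]) (f \_ D) s.
Proof.
rewrite /prim Rintegral_mkcond [RHS]Rintegral_mkcond.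
apply: eq_Rintegral => s _; rewrite !patchE.
case: ifPn => [/set_mem /=|_]; last by case: ifP.
rewrite in_itv/= => /andP[s0 _]; have [sx|sx] := leP s x.
  by rewrite mem_set ?mulr1//= in_itv/= sx.
by rewrite memNset ?mulr0//= in_itv/= (leNgt s x) sx.
Qed.

Lemma prim_continuous f : L1 f -> continuous (prim f).
Proof.
move=> hf t0; set a := Num.min t0 0 - 1.
have m1 : Num.min t0 0 <= t0 by rewrite ge_min lexx.
have m2 : Num.min t0 0 <= 0 by rewrite ge_min lexx orbT.
have a0 : a <= 0 by rewrite /a; lra.
have at0 : a < t0 by rewrite /a; lra.
rewrite (_ : prim f = (fun x => \int[mu]_(s in `[a, x]) (f \_ D) s)); last first.
  by apply/funext => x; exact: primE_itv.
apply: (@within_continuous_continuous _ _ _ a (t0 + 1)); first lra.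
  apply: (@parameterized_integral_continuous R a (t0 + 1) (f \_ D)); first lra.
  by apply: integrableS (L1_restrict hf).
by rewrite in_itv/= at0/= ltrDl.
Qed.

Lemma prim_derivable_ae f : L1 f ->
  {ae mu, forall t, t \in `]0, T[ -> derivable (prim f) t 1 /\ derive1 (prim f) t = f t}.
Proof.
move=> hf; have hi := L1_restrict hf.
have := @FTC1Ny R (f \_ D).
have E : prim f = (fun x => \int[mu]_(s in `]-oo, x]) (f \_ D) s).
  by apply/funext => x; exact: primE_Nyitv.
rewrite E.
have hl : locally_integrable setT (f \_ D) by apply: open_integrable_locally; [exact: openT|].
move=> /(_ _ hl) h; have hy y : mu.-integrable `]-oo, y] (EFin \o (f \_ D)) by apply: integrableS hi.
case: (h hy) => N [mN N0 hN]; exists N; split => // t /= nt; apply: hN => /= -[dt e].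
by apply: nt => tD; split => //; rewrite e patchE mem_set.
Qed.

Lemma prim_derivable f t : L1 f -> {for t, continuous f} -> t \in `]0, T[ ->
  derivable (prim f) t 1 /\ derive1 (prim f) t = f t.
Proof.
move=> hf cf tD; have hi := L1_restrict hf.
have := @continuous_FTC1 R (f \_ D) -oo%O t (t + 1).
have E : prim f = (fun x => \int[mu]_(s in `]-oo, x]) (f \_ D) s).
  by apply/funext => x; exact: primE_Nyitv.
rewrite E.
rewrite ltrDl patchE mem_set//; apply => //; first by apply: integrableS hi.
  by rewrite ltNyr.
have /= near_tD : \forall x \near t, x \in D.
  apply: filterS (near_in_itvoo tD) => x xD; exact: mem_set.
rewrite /prop_for/continuous_at patchE mem_set//.
apply: cvg_trans cf; apply: near_eq_cvg; near=> x.
by rewrite patchE ifT//; near: x.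
Unshelve. all: by end_near. Qed.

(** With l = 2 C, the weighted function d(t) exp(-l t) attains its maximum m at some c. Inserting
    d(s) <= m exp(l s) into the hypothesis at c makes the integral term at most half of d(c), so
    that it is absorbed by the left side. This accounts for the factor 2 and the doubled rate. *)
Lemma gronwall (d : R -> R) (e C : R) : 0 <= e -> 0 < C -> continuous d ->
  (forall t, t \in `[0, T] -> 0 <= d t <= e + C * prim d t) ->
  forall t, t \in `[0, T] -> d t <= 2 * e * expR (2 * C * T).
Proof.
move=> e0 C0 cd hd; set l := 2 * C.
have l0 : 0 < l by rewrite mulr_gt0.
pose ex (t : R) := expR (l * t).
have cex : continuous ex.
  move=> t; apply: continuous_comp; last exact: continuous_expR.
  exact: mulrl_continuous.
have L1c h : continuous h -> L1 h.
  move=> ch; apply: (@integrableS _ _ _ mu `[0, T]) => //.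
    exact: subset_itv_oo_cc.
  apply: continuous_compact_integrable; first exact: segment_compact.
  exact: continuous_subspaceT.
have primex t : t \in `[0, T] -> prim ex t = l^-1 * ex t - l^-1.
  rewrite in_itv/= => /andP[t0 tT].
  have dG x : x \in `]0, t[ -> is_derive x 1 (fun t => l^-1 * ex t - prim ex t) 0.
    rewrite in_itv/= => /andP[x0 xt].
    have xD : x \in `]0, T[ by rewrite in_itv/= x0/= (lt_le_trans xt).
    have [dp ep] := prim_derivable (L1c _ cex) (cex x) xD.
    have ip : is_derive x 1 (prim ex) (ex x).
      by apply: DeriveDef; [exact: dp|rewrite -derive1E; exact: ep].
    have ie : is_derive x 1 ex (l * ex x).
      have : is_derive x 1 (fun t : R => l * t) l.
        apply: is_derive_eq.

        by rewrite /GRing.scale/= mulr1.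
      move=> il; have := @is_derive1_comp R expR (fun t : R => l * t) x _ _ (is_derive_expR _) il.
      by rewrite mulrC.
    apply: is_derive_eq; rewrite /GRing.scale/=.
    by rewrite mulrA mulVf ?gt_eqF// mul1r subrr.
  have cG : {within `[0, t], continuous (fun t => l^-1 * ex t - prim ex t)}.
    apply: continuous_subspaceT; apply: contB; first exact: contZ.
    exact: prim_continuous (L1c _ cex).
  have [c _] := MVT_segment t0 dG cG.
  by rewrite mul0r (prim_le0 _ (lexx 0)) /ex mulr0 expR0 mulr1 subr0 => /eqP; rewrite subr_eq0 => /eqP; lra.
pose E t := d t * expR (- (l * t)).
have cE : continuous E.
  apply: contM => // t; apply: continuous_comp; last exact: continuous_expR.
  by apply: cvgN; exact: mulrl_continuous.
have [c cT mE] := @EVT_max R E 0 T (ltW T0) (continuous_subspaceT cE).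
have dE t : t \in `[0, T] -> d t <= E c * ex t.
  move=> /mE; rewrite /E expRN -/(ex t) ler_pdivrMr ?expR_gt0//.
have Ec0 : 0 <= E c by rewrite mulr_ge0 ?expR_ge0//; case/andP: (hd _ cT).
have prim_d : prim d c <= E c * (l^-1 * ex c).
  apply: (@le_trans _ _ (prim (fun s => E c * ex s) c)).
    apply: prim_le => //; [exact: L1c|by apply: L1Z; exact: L1c|].
    move=> s Ds _; apply: dE; exact: subset_itv_oo_cc.
  rewrite primZ; last exact: L1c.
  by rewrite ler_wpM2l// primex// lerBlDr lerDl invr_ge0 ltW.
have Ec : E c <= 2 * e.
  have := hd _ cT => /andP[_ h1].
  have h2 : d c <= e + C * (E c * (l^-1 * ex c)).
    by rewrite (le_trans h1)// lerD2l ler_pM2l.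
  have h3 : C * (E c * (l^-1 * ex c)) = E c / 2 * ex c.
    by rewrite /l; field; rewrite gt_eqF.
  have h4 : E c * ex c = d c.
    by rewrite /E expRN mulfVK// gt_eqF// expR_gt0.
  have ex1 : 1 <= ex c.
    rewrite -expR0 ler_expR mulr_ge0 ?(ltW l0)//; by move: cT; rewrite in_itv/= => /andP[].
  have h5 : E c / 2 * ex c <= e.
    by rewrite -h4 h3 in h2; lra.
  have : E c / 2 * 1 <= E c / 2 * ex c by rewrite ler_wpM2l// divr_ge0.
  by lra.
move=> t tT; rewrite (le_trans (dE t tT))// ler_pM ?expR_ge0//.
rewrite ler_expR ler_pM2l//; by move: tT; rewrite in_itv/= => /andP[].
Qed.

End primitive.

Ltac L1tac := repeat first [assumption | apply: L1B | apply: L1D | apply: L1Z].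

(** * Lipschitz and Taylor estimates from bounded derivatives *)

Section bounded_derivatives.
Variables (R : realType) (f : R -> R).
Hypothesis hf : bounded_derivatives f.

(** The second derivative need not be continuous, so everything goes through the mean value theorem,
    applied to f and to f'. The Taylor remainder is (f'(c) - f'(z)) (y - z) with c between y and z,
    which costs the constant B instead of B / 2. Taking M + 1 for B makes it positive. *)
Lemma bounded_derivatives_bound : exists B : R, [/\ 0 < B,
  forall z, `|derive1 f z| <= B,
  forall y z, `|derive1 f y - derive1 f z| <= B * `|y - z|,
  forall y z, `|f y - f z| <= B * `|y - z| &
  forall y z, `|f y - f z - derive1 f z * (y - z)| <= B * (y - z) ^+ 2].
Proof.
case: hf => df ddf [M hM].
have M1 z : `|derive1 f z| <= M + 1.
  have : `|derive1 f z| + `|derive1 (derive1 f) z| <= M by apply: hM; exists z.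
  by have := normr_ge0 (derive1 (derive1 f) z); lra.
have M2 z : `|derive1 (derive1 f) z| <= M + 1.
  have : `|derive1 f z| + `|derive1 (derive1 f) z| <= M by apply: hM; exists z.
  by have := normr_ge0 (derive1 f z); lra.
have M0 : 0 < M + 1.
  have : `|derive1 f 0| + `|derive1 (derive1 f) 0| <= M by apply: hM; exists 0.
  have := normr_ge0 (derive1 f 0); have := normr_ge0 (derive1 (derive1 f) 0); lra.
have mvt (h : R -> R) : (forall z, derivable h z 1) -> forall y z, exists c,
    [/\ `|c - z| <= `|y - z| & h y - h z = derive1 h c * (y - z)].
  move=> dh.
  have ch : continuous h.
    by move=> z; apply: differentiable_continuous; apply/derivable1_diffP.
  have ih (z : R) : is_derive z 1 h (derive1 h z).
    by rewrite derive1E; apply: DeriveDef.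
  move=> y z; have [yz|zy] := leP y z.
    have [c] := @MVT_segment _ h (derive1 h) y z yz (fun x _ => ih x) (continuous_subspaceT ch).
    rewrite in_itv/= => /andP[yc cz] e; exists c; split.
      by rewrite !ler0_norm ?subr_le0//; lra.
    by rewrite -opprB e; ring.
  have [c] := @MVT_segment _ h (derive1 h) z y (ltW zy) (fun x _ => ih x) (continuous_subspaceT ch).
  rewrite in_itv/= => /andP[zc cy] e; exists c; split => //.
  by rewrite !ger0_norm ?subr_ge0//; lra.
have lip y z : `|derive1 f y - derive1 f z| <= (M + 1) * `|y - z|.
  by have [c [_ ->]] := mvt _ ddf y z; rewrite normrM ler_wpM2r.
exists (M + 1); split => // y z.
  by have [c [_ ->]] := mvt _ df y z; rewrite normrM ler_wpM2r.
have [c [cz ->]] := mvt _ df y z.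
rewrite -mulrBl normrM -(real_normK (num_real (y - z))) expr2 mulrA ler_wpM2r//.
by rewrite (le_trans (lip _ _))// ler_pM2l.
Qed.

End bounded_derivatives.

(** * Elementary inequalities, limits and joint measurability *)

Lemma stability_algebra (R : realType) (B u q i a b ci : R) :
  0 <= ci -> 0 <= a -> 0 <= b -> 0 <= B ->
  u + ci * (i + b) + (q + B * a) <= u + q + ci * i + (ci + B) * (a + b).
Proof.
move=> ci0 a0 b0 B0; rewrite -subr_ge0.
have -> : u + q + ci * i + (ci + B) * (a + b) - (u + ci * (i + b) + (q + B * a)) =
  ci * a + B * b by ring.
by rewrite addr_ge0 ?mulr_ge0.
Qed.

(** Here a and b stand for the values at x and y, q and q' for the initial momenta, and j and j' for
    the cost of each optimal control started from the other point. Adding the two chains of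
    inequalities cancels a and b and leaves (y - x) (q - q') <= 2 M (y - x)^2. *)
Lemma mono_algebra (R : realType) (x y q q' a b j j' M : R) : x < y ->
  j <= a - (y - x) * q + M * (y - x) ^+ 2 -> j' <= b - (x - y) * q' + M * (x - y) ^+ 2 ->
  b <= j -> a <= j' -> q + 2 * M * x <= q' + 2 * M * y.
Proof.
move=> xy h1 h2 h3 h4; rewrite -subr_ge0.
have yx : 0 < y - x by rewrite subr_gt0.
rewrite -(pmulr_rge0 _ yx).
have -> : (y - x) * (q' + 2 * M * y - (q + 2 * M * x)) =
  (a - (y - x) * q + M * (y - x) ^+ 2 - b) + (b - (x - y) * q' + M * (x - y) ^+ 2 - a) by ring.
by rewrite addr_ge0// subr_ge0; [exact: le_trans h1|exact: le_trans h2].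
Qed.

Lemma descent_algebra (R : realType) (j p s X Y C : R) :
  j + s * Y <= p + s * X -> s * X - s * Y <= s * C -> j <= p + s * C.
Proof. lra. Qed.

Lemma limit_algebra (R : realType) (x r c y e : R) :
  `|x - r| < e / 2 -> r <= c + y -> y <= e / 2 -> x <= c + e.
Proof. by move=> /(le_lt_trans (ler_norm _)); lra. Qed.

Lemma ler_addharmonic (R : realType) (a b C : R) :
  (forall n : nat, a <= b + C * n.+1%:R^-1) -> a <= b.
Proof.
move=> h; apply/ler_addgt0Pr => e e0.
have C1 : 0 < `|C| + 1 by have := normr_ge0 C; lra.
near \oo => n.
apply: (le_trans (h n)); rewrite lerD2l.
apply: (@le_trans _ _ ((`|C| + 1) * n.+1%:R^-1)).
  by rewrite ler_pM2r ?invr_gt0// (le_trans (ler_norm _))// lerDl.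
rewrite mulrC -ler_pdivlMr//; apply: ltW; near: n.
by apply: near_infty_natSinv_lt (PosNum (divr_gt0 e0 C1)).
Unshelve. all: by end_near. Qed.

Lemma lip_continuous (R : realType) (C : R) (f : R -> R) : 0 < C ->
  (forall y z, `|f y - f z| <= C * `|y - z|) -> continuous f.
Proof.
move=> C0 lf x; apply/cvgrPdist_lt => e e0; near=> y.
rewrite (le_lt_trans (lf _ _))// mulrC -ltr_pdivlMr//.
near: y; apply/nbhs_ballP; exists (e / C) => //=; exact: divr_gt0.
Unshelve. all: by end_near. Qed.

(* Sampling the first variable at the grid points k / (n + 1) leaves countably
   many measurable slices. *)
Lemma caratheodory_measurable (R : realType) (F : R -> R -> R) :
  (forall x, continuous (F ^~ x)) -> (forall t, measurable_fun setT (F t)) ->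
  measurable_fun setT (fun p : measurableTypeR R * measurableTypeR R => F p.1 p.2).
Proof.
move=> cF mF.
pose grid (n : nat) (t : R) : R := (Num.floor (t * n.+1%:R))%:~R / n.+1%:R.
have mono_grid n : nondecreasing_fun (grid n).
  move=> s t st; rewrite /grid ler_pM2r ?invr_gt0// ler_int.
  by apply: le_floor; rewrite ler_pM2r.
apply: (measurable_fun_cvg (h := fun n (p : measurableTypeR R * measurableTypeR R) =>
    F (grid n p.1) p.2)).
  move=> n _ Y mY; rewrite setTI.
  have -> : (fun p : measurableTypeR R * measurableTypeR R => F (grid n p.1) p.2) @^-1` Y =
      \bigcup_(k : int) ((grid n @^-1` [set k%:~R / n.+1%:R]) `*` (F (k%:~R / n.+1%:R) @^-1` Y)).
    apply/seteqP; split => [[t x] /= h|[t x] [k _ [/= -> //]]].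
    by exists (Num.floor (t * n.+1%:R)).
  apply: countable_bigcupT_measurable; first exact: countableP.
  move=> k; apply: measurableX.
    rewrite -[X in measurable X]setTI.
    by apply: (nondecreasing_measurable measurableT (mono_grid n)) => //; exact: measurable_set1.
  by rewrite -[X in measurable X]setTI; exact: mF.
move=> [t x] _; apply: (continuous_cvg _ (cF x t)).
apply/cvgrPdist_lt => e e0; near=> n.
have n0 : (0 : R) < n.+1%:R by [].
have /andP[h1 h2] := floor_itv (t * n.+1%:R).
rewrite ger0_norm /grid; last by rewrite subr_ge0 ler_pdivrMr.
apply: (@le_lt_trans _ _ (n.+1%:R^-1)).
  rewrite lerBlDr -(ler_pM2r n0) mulrDl mulVf ?gt_eqF// divfK ?gt_eqF//.
  by move: h2; rewrite intrD addrC => /ltW.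
near: n; exact: near_infty_natSinv_lt (PosNum e0).
Unshelve. all: by end_near. Qed.

(** * The cost as a functional of the velocity *)

Section reduced_problem.
Variables (R : realType) (T c0 B : R) (V V' g g' : R -> R).
Hypotheses (T0 : 0 < T) (c0_gt0 : 0 < c0) (B0 : 0 < B).
Hypothesis V'B : forall z, `|V' z| <= B.
Hypothesis g'B : forall z, `|g' z| <= B.
Hypothesis V'_lip : forall y z, `|V' y - V' z| <= B * `|y - z|.
Hypothesis g'_lip : forall y z, `|g' y - g' z| <= B * `|y - z|.
Hypothesis V_lip : forall y z, `|V y - V z| <= B * `|y - z|.
Hypothesis g_lip : forall y z, `|g y - g z| <= B * `|y - z|.
Hypothesis V_taylor : forall y z, `|V y - V z - V' z * (y - z)| <= B * (y - z) ^+ 2.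
Hypothesis g_taylor : forall y z, `|g y - g z - g' z * (y - z)| <= B * (y - z) ^+ 2.
Local Notation mu := (@lebesgue_measure R).
Local Notation D := (`]0, T[%classic : set (measurableTypeR R)).
Local Notation Int := (Rintegral mu D).
Local Notation L1 := (integrable_oo T).
Local Notation S2 := (square_integrable T).
Local Notation P := (prim T).
Implicit Types (f h k v w : R -> R) (x y a t : R).

Definition traj x v t : R := x + P v t.
Definition J w x v : R :=
  Int (fun t => c0 / 2 * v t ^+ 2 + v t * w t + V (traj x v t)) + g (traj x v T).
Definition mom0 x v : R := - g' (traj x v T) - Int (fun s => V' (traj x v s)).
(* - g'(z(T)) - (the integral of V'(z) over [t,T]), written from its value at 0 *)
Definition mom x v t : R := mom0 x v + P (fun s => V' (traj x v s)) t.
Definition res w x v t : R := c0 * v t + w t - mom x v t.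

Lemma traj_continuous x v : S2 v -> continuous (traj x v).
Proof.
move=> hv; apply: contD; first by move=> ?; exact: cst_continuous.
exact: (prim_continuous (S2_L1 T0 hv)).
Qed.

Lemma continuous_measurable_D f : continuous f -> measurable_fun D f.
Proof. by move=> cf; apply: measurable_funTS; exact: continuous_measurable_fun. Qed.

Lemma continuous_L1 f : continuous f -> L1 f.
Proof.
move=> ch; apply: (@integrableS _ _ _ mu `[0, T]) => //.
  exact: subset_itv_oo_cc.
apply: continuous_compact_integrable; first exact: segment_compact.
exact: continuous_subspaceT.
Qed.

Lemma continuous_lip_comp f h : (forall y z, `|f y - f z| <= B * `|y - z|) ->
  continuous h -> continuous (f \o h).
Proof. by move=> lf ch t; apply: continuous_comp; [exact: ch|exact: (lip_continuous B0)]. Qed.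

Lemma V'traj_continuous x v : S2 v -> continuous (fun s => V' (traj x v s)).
Proof. by move=> hv; apply: continuous_lip_comp => //; exact: traj_continuous. Qed.

Lemma Vtraj_continuous x v : S2 v -> continuous (fun s => V (traj x v s)).
Proof. by move=> hv; apply: continuous_lip_comp => //; exact: traj_continuous. Qed.

Lemma mom_continuous x v : S2 v -> continuous (mom x v).
Proof.
move=> hv; apply: contD; first by move=> ?; exact: cst_continuous.
exact: (prim_continuous (continuous_L1 (V'traj_continuous hv))).
Qed.

(** The terminal cost contributes B to the momentum and the potential B T. As B bounds first and
    second derivatives alike, the same number is a Lipschitz constant of the value and of [mom0],
    and the constant in [J_shift]. *)
Definition momB : R := B * (T + 1).

Lemma momB_ge0 : 0 <= momB. Proof. by rewrite mulr_ge0 ?addr_ge0 ?ltW. Qed.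

Lemma Int_V'_le x v (b : R -> R) : S2 v -> measurable_fun D b ->
  (forall t, D t -> `|b t| <= 1) ->
  `|Int (fun s => V' (traj x v s) * b s)| <= B * T.
Proof.
move=> hv mb b1; rewrite -Int_cst//; apply: Int_norm_le => //.
- exact: L1_mul_bounded (continuous_L1 (V'traj_continuous hv)) mb b1.
- exact: L1_cst.
- by move=> t Dt; rewrite normrM -[leRHS]mulr1 ler_pM// b1.
Qed.

Lemma mom0_le x v : S2 v -> `|mom0 x v| <= momB.
Proof.
move=> hv; rewrite (le_trans (ler_normB _ _))// normrN /momB mulrDr mulr1 addrC lerD//.
have := @Int_V'_le x v (fun=> 1) hv; under eq_Int do rewrite mulr1; apply => //.
by move=> t _; rewrite normr1.
Qed.

Lemma mom_le x v t : S2 v -> `|mom x v t| <= momB.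
Proof.
move=> hv; have hL := continuous_L1 (V'traj_continuous (x := x) hv).
have -> : mom x v t = - g' (traj x v T) -
    Int (fun s => V' (traj x v s) * (1 - (s <= t)%R%:R)).
  rewrite /mom /mom0 -addrA; congr (_ + _).
  under [in RHS]eq_Int do rewrite mulrBr mulr1.
  by rewrite IntB//; [rewrite opprB addrC|exact: L1_cut].
rewrite (le_trans (ler_normB _ _))// normrN /momB mulrDr mulr1 addrC lerD//.
apply: Int_V'_le => //.
  apply: measurable_funB => //; apply: measurable_funTS; exact: measurable_ler_nat.
by move=> s _; case: (s <= t)%R; rewrite ?subrr ?subr0 ?normr0 ?normr1.
Qed.

Lemma trajD x a v k t : S2 v -> S2 k ->
  traj (x + a) (fun s => v s + k s) t = traj x v t + (a + P k t).
Proof. by move=> hv hk; rewrite /traj primD; [ring|exact: S2_L1..]. Qed.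

Lemma J_L1 w x v : S2 w -> S2 v ->
  L1 (fun t => c0 / 2 * v t ^+ 2 + v t * w t + V (traj x v t)).
Proof.
move=> hw hv; apply: L1D; last exact: continuous_L1 (Vtraj_continuous hv).
by apply: L1D; [apply: L1Z; case: hv|exact: S2_mul].
Qed.

Lemma res_S2 w x v : S2 w -> S2 v -> S2 (res w x v).
Proof.
move=> hw hv; apply: S2B => //; first by apply: S2D => //; exact: S2Z.
apply: (S2_bounded T0 (M := momB)) => [|t _]; last exact: mom_le.
exact: continuous_measurable_D (mom_continuous hv).
Qed.

(** The trajectory is displaced by a + P k. The kinetic and price terms expand exactly; V and g are
    expanded to first order with quadratic remainder. Integration by parts turns the pairing of V'
    with P k into a pairing with k itself, after which the linear terms collect into - a p(0) and
    the pairing of the residual with k. The case a = 0 gives the gradient step, the case k = 0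
    semiconcavity. *)
Lemma J_expand w x a v k : S2 w -> S2 v -> S2 k ->
  J w (x + a) (fun t => v t + k t) <= J w x v - a * mom0 x v
    + Int (fun t => res w x v t * k t) + c0 / 2 * Int (fun t => k t ^+ 2)
    + B * (Int (fun t => (a + P k t) ^+ 2) + (a + P k T) ^+ 2).
Proof.
move=> hw hv hk; pose h t := a + P k t.
have addKrC (b c : R) : b + c - b = c by ring.
have hvk : S2 (fun t => v t + k t) by exact: S2D.
have Lk := S2_L1 T0 hk.
have ch : continuous h.
  apply: contD; first by move=> ?; exact: cst_continuous.
  exact: (prim_continuous Lk).
have cV := V'traj_continuous (x := x) hv; set U := fun s => V' (traj x v s) in cV *.
have LU : L1 U := continuous_L1 cV.
have LPk : L1 (P k) := continuous_L1 (prim_continuous Lk).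
have LUPk : L1 (fun t => U t * P k t).
  by apply: continuous_L1; apply: contM => //; exact: (prim_continuous Lk).
have Lh2 : L1 (fun t => h t ^+ 2).
  by apply: continuous_L1; exact: contX.
have [_ Lk2] := hk.
have Lvk := S2_mul hv hk. have Lkw := S2_mul hk hw.
have LJ := J_L1 x hw hv.
have bound : Int (fun t => c0 / 2 * (v t + k t) ^+ 2 + (v t + k t) * w t
      + V (traj (x + a) (fun t => v t + k t) t)) <=
    Int (fun t => (c0 / 2 * v t ^+ 2 + v t * w t + V (traj x v t)) +
      ((c0 * (v t * k t) + k t * w t) + (c0 / 2 * k t ^+ 2 + (a * U t + (U t * P k t + B * h t ^+ 2))))).
  apply: Int_le; [exact: J_L1| |].
    by L1tac.
  move=> t _; rewrite trajD//.
  have := V_taylor (traj x v t + h t) (traj x v t).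
  rewrite addKrC -/(U t) => /(le_trans (ler_norm _)) hV.
  rewrite -/(h t).
  have -> : c0 / 2 * (v t + k t) ^+ 2 = c0 / 2 * v t ^+ 2 + c0 * (v t * k t) + c0 / 2 * k t ^+ 2.
    by field.
  have hU : U t * h t = a * U t + U t * P k t by rewrite /h; ring.
  by move: hV; rewrite hU; lra.
move: bound; set X0 := (X in X <= _).
rewrite IntD; [|by L1tac..].
set Y0 := (X in X0 <= X + _).
rewrite IntD; [|by L1tac..].
rewrite IntD; [|by L1tac..].
rewrite IntD; [|by L1tac..].
rewrite IntD; [|by L1tac..].
rewrite IntD; [|by L1tac..].
rewrite !IntZ// => bound.
have ibp : Int (fun t => U t * P k t) = Int (fun s => k s * (Int U - P U s)) by exact: Int_by_parts.
have resE : Int (fun t => res w x v t * k t) = c0 * Int (fun t => v t * k t)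
    + Int (fun t => k t * w t) + g' (traj x v T) * Int k + Int (fun s => k s * (Int U - P U s)).
  have LkU : L1 (fun s => k s * (Int U - P U s)).
    apply: S2_mul => //; apply: (S2_bounded T0 (M := `|Int U| + Int (fun s => `|U s|))).
      apply: measurable_funB => //; apply: continuous_measurable_D.
      exact: (prim_continuous LU).
    by move=> t _; rewrite (le_trans (ler_normB _ _))// lerD2l prim_norm_le.
  rewrite -!IntZ// -!IntD; try by L1tac.
  by apply: eq_Int => t _; rewrite /res /mom /mom0 -/U; ring.
have := g_taylor (traj x v T + h T) (traj x v T).
rewrite addKrC => /(le_trans (ler_norm _)) hg.
have hT : h T = a + Int k by rewrite /h prim_geT.
rewrite {1}/J -/X0 trajD// -/(h T) resE /J -/Y0 -ibp /mom0 -/U.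
rewrite hT in hg *; lra.
Qed.

(** The kinetic term gives c0 / 2. The rest comes from the bound of (P k)^2 by T times the integral
    of k^2, used once integrated over ]0,T[ and once at T. *)
Definition curv : R := c0 / 2 + momB * T.

Lemma curv_gt0 : 0 < curv.
Proof. by rewrite ltr_pwDl ?divr_gt0// mulr_ge0 ?momB_ge0 ?ltW. Qed.

Lemma J_descent w x v k : S2 w -> S2 v -> S2 k ->
  J w x (fun t => v t + k t) <=
  J w x v + Int (fun t => res w x v t * k t) + curv * Int (fun t => k t ^+ 2).
Proof.
move=> hw hv hk; have := J_expand x 0 hw hv hk; rewrite addr0 mul0r subr0 add0r.
set I := Int (fun t => k t ^+ 2).
have hP t : P k t ^+ 2 <= T * I by exact: prim_sqr_le.
have cP : continuous (P k) by exact: prim_continuous (S2_L1 T0 hk).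
have hI : Int (fun t => (0 + P k t) ^+ 2) <= T * I * T.
  rewrite -Int_cst//; apply: Int_le; last by move=> t _; rewrite add0r.
    by under eq_fun do rewrite add0r; apply: continuous_L1; exact: contX.
  exact: L1_cst.
have hB : B * (Int (fun t => (0 + P k t) ^+ 2) + P k T ^+ 2) <= B * (T * I * T + T * I).
  by rewrite ler_pM2l// lerD.
by rewrite /curv /momB; lra.
Qed.

(** The control is kept and only the start moves. If v is optimal at x, this bounds the value near x
    from above with slope - p(0). *)
Lemma J_shift w x a v : S2 w -> S2 v ->
  J w (x + a) v <= J w x v - a * mom0 x v + momB * a ^+ 2.
Proof.
move=> hw hv.
have h0 : S2 (fun=> 0) by apply: (S2_bounded T0 (M := 0)) => // t _; rewrite normr0.
have := J_expand x a hw hv h0.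
have P0 t : P (fun=> 0) t = 0.
  rewrite /prim (@eq_Int _ _ _ (fun=> 0)) ?Int_cst ?mul0r// => s _.
  by rewrite mul0r.
rewrite P0 addr0 (@eq_Int _ _ (fun t => (a + _) ^+ 2) (fun=> a ^+ 2)); last first.
  by move=> t _; rewrite P0 addr0.
rewrite (@eq_Int _ _ (fun t => res w x v t * 0) (fun=> 0)); last by move=> t _; rewrite mulr0.
rewrite (@eq_Int _ _ (fun t : R => 0 ^+ 2) (fun=> 0)); last by move=> t _; rewrite expr0n.
rewrite !Int_cst// (_ : (fun t => v t + 0) = v); last by apply/funext => t; rewrite addr0.
by rewrite /momB; lra.
Qed.

Lemma J_lip w x a v : S2 w -> S2 v -> J w (x + a) v <= J w x v + momB * `|a|.
Proof.
move=> hw hv; rewrite /J.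
have hZ t : traj (x + a) v t - traj x v t = a by rewrite /traj; ring.
have hV t : V (traj (x + a) v t) <= V (traj x v t) + B * `|a|.
  by have := V_lip (traj (x + a) v t) (traj x v t); rewrite hZ => /(le_trans (ler_norm _)); lra.
have hg : g (traj (x + a) v T) <= g (traj x v T) + B * `|a|.
  by have := g_lip (traj (x + a) v T) (traj x v T); rewrite hZ => /(le_trans (ler_norm _)); lra.
have : Int (fun t => c0 / 2 * v t ^+ 2 + v t * w t + V (traj (x + a) v t)) <=
    Int (fun t => (c0 / 2 * v t ^+ 2 + v t * w t + V (traj x v t)) + B * `|a|).
  apply: Int_le; [exact: J_L1|apply: L1D; [exact: J_L1|exact: L1_cst]|].
  by move=> t _; have := hV t; lra.
rewrite [X in _ <= X -> _]IntD//; [|exact: J_L1|exact: L1_cst].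
by rewrite Int_cst// /momB; lra.
Qed.

(** The potentials lose at most [momB] times the integral of |v| against a resting trajectory, and
    c0 r^2 / 2 - r (|w| + momB) is minimized over r pointwise. Such a lower bound makes [phi] a
    genuine infimum, as [inf] returns a default value on sets that are not bounded below. *)
Definition J_min w x : R :=
  T * V x + g x - Int (fun t => (`|w t| + momB) ^+ 2 / (2 * c0)).

Lemma J_lower w x v : S2 w -> S2 v -> J_min w x <= J w x v.
Proof.
move=> hw hv; have Lv := S2_L1 T0 hv; set I := Int (fun t => `|v t|).
have hI t : `|P v t| <= I by exact: prim_norm_le.
have I0 : 0 <= I by exact: Int_ge0.
have hZ (f : R -> R) t : (forall y z, `|f y - f z| <= B * `|y - z|) ->
    f x - B * I <= f (traj x v t).
  move=> /(_ x (traj x v t)); rewrite /traj opprD addNKr normrN.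
  have : B * `|P v t| <= B * I by rewrite ler_pM2l.
  by move=> h1 /(le_trans (ler_norm _)); lra.
have [_ Lv2] := hv; have Lvw := S2_mul hv hw; have Lav := L1_norm Lv.
have Laux : L1 (fun t => c0 / 2 * v t ^+ 2 + v t * w t) by L1tac.
have Lw : L1 (fun t => (`|w t| + momB) ^+ 2 / (2 * c0)).
  have Sw : S2 (fun t => `|w t| + momB).
    apply: S2D; last by apply: (S2_bounded T0 (M := `|momB|)).
    case: hw => mw hw; split; first by apply: measurableT_comp.
    by apply: (L1_eq hw) => t _; rewrite real_normK// num_real.
  by case: Sw => _ Sw; apply: (L1_eq (L1Z (2 * c0)^-1 Sw)) => t _; rewrite mulrC.
have h1 : Int (fun t => (c0 / 2 * v t ^+ 2 + v t * w t) + (V x - B * I)) <=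
    Int (fun t => c0 / 2 * v t ^+ 2 + v t * w t + V (traj x v t)).
  apply: Int_le; [by apply: L1D => //; exact: L1_cst|exact: J_L1|].
  by move=> t _; rewrite lerD2l hZ.
have h2 : Int (fun t => momB * `|v t| - (`|w t| + momB) ^+ 2 / (2 * c0)) <=
    Int (fun t => c0 / 2 * v t ^+ 2 + v t * w t).
  apply: Int_le => //; first by L1tac.
  move=> t _; rewrite -(real_normK (num_real (v t))).
  have hvw : - (`|v t| * `|w t|) <= v t * w t by rewrite -normrM lerNl -normrN ler_norm.
  have : 0 <= (c0 * `|v t| - (`|w t| + momB)) ^+ 2 / (2 * c0).
    by rewrite divr_ge0 ?sqr_ge0// mulr_ge0 ?ltW.
  have -> : (c0 * `|v t| - (`|w t| + momB)) ^+ 2 / (2 * c0) =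
     c0 / 2 * `|v t| ^+ 2 - `|v t| * (`|w t| + momB) + (`|w t| + momB) ^+ 2 / (2 * c0).
    by field; rewrite gt_eqF.
  by lra.
move: h1 h2; rewrite IntD//; last exact: L1_cst.
rewrite Int_cst// IntB//; last by L1tac.
rewrite IntZ// -/I /J /J_min => h1 h2.
have := hZ g T g_lip.
have e1 : momB * I = B * I * T + B * I by rewrite /momB; ring.
by move: h1 h2; rewrite e1; lra.
Qed.

Definition phi w x : R := inf [set J w x v | v in [set v | S2 v]].

Lemma S2_0 : S2 (fun=> 0).
Proof. by apply: (S2_bounded T0 (M := 0)) => // t _; rewrite normr0. Qed.

Let phi_nonempty w x : [set J w x v | v in [set v | S2 v]] !=set0.
Proof. by exists (J w x (fun=> 0)); exists (fun=> 0) => //; exact: S2_0. Qed.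

Lemma phi_le w x v : S2 w -> S2 v -> phi w x <= J w x v.
Proof.
move=> hw hv; apply: ge_inf; last by exists v.
by exists (J_min w x) => _ [u hu <-]; exact: J_lower.
Qed.

Lemma phi_ge w x c : (forall v, S2 v -> c <= J w x v) -> c <= phi w x.
Proof. by move=> h; apply: lb_le_inf => // _ [u hu <-]; exact: h. Qed.

Lemma phi_approx w x e : S2 w -> 0 < e -> exists2 v, S2 v & J w x v < phi w x + e.
Proof.
move=> hw e0; have [|_ [v hv <-] h] := @inf_adherent _ [set J w x v | v in [set v | S2 v]] e e0.
  split => //; exists (J_min w x) => _ [u hu <-]; exact: J_lower.
by exists v.
Qed.

Lemma phi_shift w x a : S2 w -> phi w (x + a) <= phi w x + momB * `|a|.
Proof.
move=> hw; rewrite -lerBlDr; apply: phi_ge => v hv; rewrite lerBlDr.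
exact: le_trans (phi_le _ hw hv) (J_lip _ _ hw hv).
Qed.

Lemma phi_lip w x y : S2 w -> `|phi w x - phi w y| <= momB * `|x - y|.
Proof.
move=> hw; rewrite ler_norml; apply/andP; split.
  have := phi_shift x (y - x) hw; rewrite addrC subrK distrC; lra.
by have := phi_shift y (x - y) hw; rewrite addrC subrK; lra.
Qed.

(** The step length 1 / (2 curv) is optimal for the bound of [J_descent]. It lowers the cost by the
    integral of the squared residual over 4 curv, and the cost cannot fall below [phi]. *)
Lemma res_sqr_le w x v : S2 w -> S2 v ->
  Int (fun t => res w x v t ^+ 2) <= 4 * curv * (J w x v - phi w x).
Proof.
move=> hw hv; have hr := res_S2 x hw hv; have [_ Lr] := hr.
have L0 := curv_gt0; set c := - (2 * curv)^-1.
have := J_descent x hw hv (S2Z c hr).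
have := phi_le x hw (S2D hv (S2Z c hr)).
rewrite (@eq_Int _ _ (fun t => res w x v t * (c * res w x v t))
  (fun t => c * res w x v t ^+ 2)); last by move=> t _; ring.
rewrite (@eq_Int _ _ (fun t => (c * res w x v t) ^+ 2)
  (fun t => c ^+ 2 * res w x v t ^+ 2)); last by move=> t _; ring.
rewrite !IntZ//; set I := Int _ => h1 h2.
have e1 : c * I + curv * (c ^+ 2 * I) = - (I / (4 * curv)).
  by rewrite /c; field; rewrite gt_eqF.
have : I / (4 * curv) <= J w x v - phi w x by move: h1 h2; rewrite -addrA e1; lra.
by rewrite ler_pdivrMr ?mulr_gt0// mulrC.
Qed.

(** * Existence of minimizers *)

(* The tolerance is such that the residual has L^2-norm at most [e]. *)
Definition near_min w x e v : Prop := S2 v /\ J w x v <= phi w x + e ^+ 2 / (4 * curv).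

Lemma near_min_res_sqr w x e v : S2 w -> near_min w x e v ->
  Int (fun t => res w x v t ^+ 2) <= e ^+ 2.
Proof.
move=> hw [hv h]; apply: (le_trans (res_sqr_le x hw hv)).
have L0 : 0 < 4 * curv by rewrite mulr_gt0 ?curv_gt0.
by rewrite mulrC -ler_pdivlMr//; lra.
Qed.

(** Pointwise |r| <= e + r^2 / e. The L^1-norm is the one that enters [stability]. *)
Lemma near_min_res w x e v : S2 w -> 0 < e -> near_min w x e v ->
  Int (fun t => `|res w x v t|) <= e * (T + 1).
Proof.
move=> hw e0 h; have h1 := near_min_res_sqr hw h; case: h => hv _.
have hr := res_S2 x hw hv; have [_ Lr] := hr.
have : Int (fun t => `|res w x v t|) <= Int (fun t => e + e^-1 * res w x v t ^+ 2).
  apply: Int_le; [exact: L1_norm (S2_L1 T0 hr)|apply: L1D; [exact: L1_cst|exact: L1Z]|].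
  move=> t _; rewrite -(real_normK (num_real (res w x v t))); set r := `| _ |.
  have : 0 <= (e - r) ^+ 2 / e by rewrite divr_ge0 ?sqr_ge0 ?ltW.
  have -> : (e - r) ^+ 2 / e = e - 2 * r + e^-1 * r ^+ 2 by field; rewrite gt_eqF.
  by have := normr_ge0 (res w x v t); rewrite -/r; lra.
rewrite IntD//; [|exact: L1_cst|exact: L1Z].
rewrite Int_cst// IntZ// => h2; apply: (le_trans h2).
have : e^-1 * Int (fun t => res w x v t ^+ 2) <= e^-1 * e ^+ 2.
  by rewrite ler_pM2l ?invr_gt0.
have -> : e^-1 * e ^+ 2 = e by field; rewrite gt_eqF.
lra.
Qed.

Definition stab : R := 2 * expR (2 * (c0^-1 + B) * T).

Lemma stab_ge0 : 0 <= stab. Proof. by rewrite mulr_ge0 ?expR_ge0. Qed.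

(** With r the residual, trajectory and momentum solve the Hamiltonian system z' = (p - w + r) / c0,
    p' = V'(z). In the difference of two solutions the price cancels, and Gronwall's inequality
    applies to |z1 - z2| + |p1 - p2| with rate c0^-1 + B, whence a constant independent of w. *)
Lemma stability w x1 x2 v1 v2 t : S2 w -> S2 v1 -> S2 v2 -> t \in `[0, T] ->
  `|traj x1 v1 t - traj x2 v2 t| + `|mom x1 v1 t - mom x2 v2 t| <=
  stab * (`|x1 - x2| + `|mom0 x1 v1 - mom0 x2 v2|
    + c0^-1 * Int (fun t => `|res w x1 v1 t - res w x2 v2 t|)).
Proof.
move=> hw hv1 hv2 tT; set e := (X in stab * X).
set dZ := fun t => `|traj x1 v1 t - traj x2 v2 t|.
set dp := fun t => `|mom x1 v1 t - mom x2 v2 t|.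
have hr := S2B (res_S2 x1 hw hv1) (res_S2 x2 hw hv2).
have Lr := L1_norm (S2_L1 T0 hr).
have norm_cont (h : R -> R) : continuous h -> continuous (fun t => `|h t|).
  by move=> ch s; apply: continuous_comp; [exact: ch|exact: norm_continuous].
have cZ : continuous dZ by apply: norm_cont; apply: contB; exact: traj_continuous.
have cp : continuous dp by apply: norm_cont; apply: contB; exact: mom_continuous.
have LZ := continuous_L1 cZ; have Lp := continuous_L1 cp.
have e0 : 0 <= e.
  by rewrite !addr_ge0// mulr_ge0 ?invr_ge0 ?(ltW c0_gt0)//; exact: Int_ge0.
have C0 : 0 < c0^-1 + B by rewrite addr_gt0 ?invr_gt0.
have := @gronwall _ _ T0 (fun t => dZ t + dp t) e (c0^-1 + B) e0 C0 (contD cZ cp).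
rewrite /stab mulrAC => /(_ _ t tT); apply => {t tT} t tT.
rewrite addr_ge0; [|exact: normr_ge0|exact: normr_ge0].
rewrite andTb primD//.
have P0 (h : R -> R) : (forall s, 0 <= h s) -> 0 <= P h t.
  by move=> h0; apply: Int_ge0 => s _; rewrite mulr_ge0.
have hZ : dZ t <= `|x1 - x2| + c0^-1 * (Int (fun t => `|res w x1 v1 t - res w x2 v2 t|) + P dp t).
  rewrite /dZ (_ : traj x1 v1 t - traj x2 v2 t = (x1 - x2) + P (fun s => v1 s - v2 s) t); last first.
    by rewrite primB; [rewrite /traj; ring|exact: S2_L1..].
  apply: (le_trans (ler_normD _ _)); rewrite lerD2l.
  apply: (le_trans (prim_norm _ (S2_L1 T0 (S2B hv1 hv2)))).
  apply: (@le_trans _ _ (P (fun s => c0^-1 * (`|res w x1 v1 s - res w x2 v2 s| + dp s)) t)).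
    apply: prim_le; [exact: L1_norm (S2_L1 T0 (S2B hv1 hv2))|by L1tac|].
    move=> s _ _.
    have E : c0 * (v1 s - v2 s) = (res w x1 v1 s - res w x2 v2 s) + (mom x1 v1 s - mom x2 v2 s).
      rewrite /res; move: (mom x1 v1 s) (mom x2 v2 s) (v1 s) (v2 s) (w s) => a b c d f.
      by ring.
    have {}E : c0 * `|v1 s - v2 s| = `|(res w x1 v1 s - res w x2 v2 s) + (mom x1 v1 s - mom x2 v2 s)|.
      by rewrite -E normrM gtr0_norm.
    rewrite ler_pdivlMl// E; exact: ler_normD.
  rewrite primZ ?primD//; last by L1tac.
  rewrite ler_pM2l ?invr_gt0// lerD2r.
  apply: (le_trans (ler_norm _)); apply: (le_trans (prim_norm_le _ Lr)).
  by rewrite le_eqVlt; apply/orP; left; apply/eqP; apply: eq_Int => s _; rewrite normr_id.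
have hp : dp t <= `|mom0 x1 v1 - mom0 x2 v2| + B * P dZ t.
  have c1 := V'traj_continuous (x := x1) hv1; have c2 := V'traj_continuous (x := x2) hv2.
  rewrite /dp (_ : mom x1 v1 t - mom x2 v2 t = (mom0 x1 v1 - mom0 x2 v2) +
    P (fun s => V' (traj x1 v1 s) - V' (traj x2 v2 s)) t); last first.
    rewrite primB; [|exact: (continuous_L1 c1)|exact: (continuous_L1 c2)].
    by rewrite /mom opprD addrACA.
  apply: (le_trans (ler_normD _ _)); rewrite lerD2l.
  have L12 := L1B (continuous_L1 c1) (continuous_L1 c2).
  apply: (le_trans (prim_norm _ L12)); rewrite -primZ//.
  apply: prim_le; [exact: L1_norm|exact: L1Z|by move=> s _ _; exact: V'_lip].
have PZ := P0 dZ (fun s => normr_ge0 _); have Pp := P0 dp (fun s => normr_ge0 _).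
apply: (le_trans (lerD hZ hp)); apply: stability_algebra => //; last exact: ltW.
by rewrite invr_ge0 ltW.
Qed.

Lemma near_min_le w x e e' v : 0 <= e <= e' -> near_min w x e v -> near_min w x e' v.
Proof.
move=> /andP[e0 ee'] [hv h]; split => //; apply: (le_trans h); rewrite lerD2l.
rewrite ler_pM2r ?invr_gt0 ?mulr_gt0 ?curv_gt0// ler_pXn2r ?nnegrE//.
exact: le_trans ee'.
Qed.

Definition minimal w x v : Prop := S2 v /\ J w x v = phi w x.

Lemma minimal_near_min w x v e : minimal w x v -> near_min w x e v.
Proof.
move=> [hv eJ]; split => //; rewrite eJ lerDl divr_ge0 ?sqr_ge0// mulr_ge0//.
exact/ltW/curv_gt0.
Qed.

Lemma mom0_lip x v1 v2 : S2 v1 -> S2 v2 ->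
  `|mom0 x v1 - mom0 x v2| <= momB * Int (fun t => `|v1 t - v2 t|).
Proof.
move=> hv1 hv2; set I := Int _.
have Lv := S2_L1 T0 (S2B hv1 hv2).
have hZ t : `|traj x v1 t - traj x v2 t| <= I.
  rewrite (_ : _ - _ = P (fun s => v1 s - v2 s) t); first exact: prim_norm_le.
  by rewrite primB; [rewrite /traj; ring|exact: S2_L1..].
have L1' := continuous_L1 (V'traj_continuous (x := x) hv1).
have L2' := continuous_L1 (V'traj_continuous (x := x) hv2).
have -> : mom0 x v1 - mom0 x v2 = - (g' (traj x v1 T) - g' (traj x v2 T)) -
    Int (fun s => V' (traj x v1 s) - V' (traj x v2 s)).
  rewrite IntB// /mom0; move: (g' (traj x v1 T)) (g' (traj x v2 T)) => a b.
  move: (Int (fun s => V' (traj x v1 s))) (Int (fun s => V' (traj x v2 s))) => c d.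
  by ring.
apply: (le_trans (ler_normB _ _)); rewrite normrN /momB mulrDr mulr1 mulrDl addrC lerD//.
  rewrite mulrAC -Int_cst//; apply: Int_norm_le; [exact: L1B|exact: L1_cst|].
  by move=> t _; apply: (le_trans (V'_lip _ _)); rewrite ler_pM2l.
by apply: (le_trans (g'_lip _ _)); rewrite ler_pM2l.
Qed.

Lemma primE f t : P f t = Int (fun s => f s * (s <= t)%R%:R).
Proof. by []. Qed.

Lemma trajE x v t : traj x v t = x + P v t.
Proof. by []. Qed.

Lemma momE x v t : mom x v t = mom0 x v + P (fun s => V' (traj x v s)) t.
Proof. by []. Qed.

Lemma resE w x v t : res w x v t = c0 * v t + w t - mom x v t.
Proof. by []. Qed.

Opaque traj mom mom0 res prim integrable_oo.

Lemma near_min_diff w x e1 e2 q v1 v2 t : S2 w -> 0 < e1 -> 0 < e2 ->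
  near_min w x e1 v1 -> near_min w x e2 v2 ->
  `|mom0 x v1 - q| <= e1 -> `|mom0 x v2 - q| <= e2 -> t \in `[0, T] ->
  `|mom x v1 t - mom x v2 t| <= stab * (1 + c0^-1 * (T + 1)) * (e1 + e2).
Proof.
move=> hw e10 e20 h1 h2 q1 q2 tT.
have [[hv1 _] [hv2 _]] := (h1, h2).
have := stability x x hw hv1 hv2 tT; rewrite (subrr x) normr0 add0r => hs.
have hq : `|mom0 x v1 - mom0 x v2| <= e1 + e2.
  have -> : mom0 x v1 - mom0 x v2 = (mom0 x v1 - q) - (mom0 x v2 - q).
    by move: (mom0 x v1) (mom0 x v2) => a b; rewrite opprB subrKA.
  by rewrite (le_trans (ler_normB _ _))// lerD.
have r1 := res_S2 x hw hv1; have r2 := res_S2 x hw hv2.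
have n1 := L1_norm (S2_L1 T0 r1); have n2 := L1_norm (S2_L1 T0 r2).
have hr : Int (fun t => `|res w x v1 t - res w x v2 t|) <= (T + 1) * (e1 + e2).
  apply: (@le_trans _ _ (Int (fun t => `|res w x v1 t| + `|res w x v2 t|))).
    apply: Int_le; [exact: L1_norm (S2_L1 T0 (S2B r1 r2))|exact: L1D|].
    by move=> s _; exact: ler_normB.
  rewrite (IntD n1 n2) mulrDr; apply: lerD; rewrite [leRHS]mulrC.
      exact: (near_min_res hw e10 h1).
    exact: (near_min_res hw e20 h2).
have hr' := ler_wpM2l (_ : 0 <= c0^-1) hr.
have := le_trans (_ : `|mom x v1 t - mom x v2 t| <= _) hs.
move=> /(_ _); rewrite lerDr normr_ge0 => /(_ isT) h.
apply: (le_trans h); rewrite -mulrA ler_wpM2l ?stab_ge0// mulrDl mul1r lerD//.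
by rewrite -mulrA; apply: hr'; rewrite invr_ge0 ltW.
Qed.

(* Approximate minimizers whose initial momenta converge are Cauchy in the
   strong sense, because their residuals vanish in the limit. *)
Lemma near_min_limit w x q : S2 w ->
  (forall e, 0 < e -> exists2 v, near_min w x e v & `|mom0 x v - q| <= e) ->
  exists2 v, minimal w x v & mom0 x v = q.
Proof.
move=> hw hq.
pose ep (n : nat) : R := n.+1%:R^-1.
have ep0 n : 0 < ep n by rewrite invr_gt0.
have [|vn hvn] := @choice _ _ (fun n v => near_min w x (ep n) v /\ `|mom0 x v - q| <= ep n).
  by move=> n; have [v h1 h2] := hq _ (ep0 n); exists v.
have hn n : near_min w x (ep n) (vn n) by case: (hvn n).
have hqn n : `|mom0 x (vn n) - q| <= ep n by case: (hvn n).
have Sn n : S2 (vn n) by case: (hn n).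
set K := stab * (1 + c0^-1 * (T + 1)).
have K0 : 0 <= K.
  by rewrite mulr_ge0 ?stab_ge0// addr_ge0// mulr_ge0 ?invr_ge0 ?addr_ge0 ?ltW.
have diff n m t : D t -> `|mom x (vn n) t - mom x (vn m) t| <= K * (ep n + ep m).
  move=> Dt; apply: near_min_diff (hw) (ep0 n) (ep0 m) (hn n) (hn m) (hqn n) (hqn m) _.
  exact: subset_itv_oo_cc.
have ep_cvg (e : R) : 0 < e -> \forall n \near \oo, ep n < e.
  by move=> e0; apply: near_infty_natSinv_lt (PosNum e0).
have cv t : D t -> cvgn (fun n => mom x (vn n) t).
  move=> Dt; apply: cauchy_cvg; apply: cauchy_exP => e e0.
  have d0 : 0 < e / (2 * (K + 1)) by rewrite divr_gt0// mulr_gt0// ltr_wpDl.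
  have [N _ hN] := ep_cvg _ d0.
  exists (mom x (vn N) t).
  suff : \forall m \near \oo, ball (mom x (vn N) t) e (mom x (vn m) t) by [].
  near=> m.
  rewrite /ball/= (le_lt_trans (diff N m t Dt))//.
  have h1 : ep N < e / (2 * (K + 1)) by apply: hN => /=.
  have h2 : ep m < e / (2 * (K + 1)) by apply: hN => /=; near: m; exact: nbhs_infty_ge.
  have h3 : K * (ep N + ep m) <= K * (e / (K + 1)).
    rewrite ler_wpM2l//; have -> : e / (K + 1) = e / (2 * (K + 1)) + e / (2 * (K + 1)).
      by field; rewrite gt_eqF// ltr_wpDl.
    by rewrite lerD// ltW.
  apply: (le_lt_trans h3); rewrite mulrCA -[ltRHS]mulr1 ltr_pM2l//.
  by rewrite ltr_pdivrMr ?ltr_wpDl// mul1r ltrDl.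
(* The limit momentum; its value 0 outside ]0,T[ is arbitrary. *)
pose p t := if t \in `]0, T[ then limn (fun n => mom x (vn n) t) else 0.
have pn n t : D t -> `|mom x (vn n) t - p t| <= K * ep n.
  move=> Dt; have tD : t \in `]0, T[ by [].
  rewrite /p tD; have := cv t Dt; set l := limn _ => cl.
  apply/ler_addgt0Pr => d d0.
  have d1 : 0 < d / 2 / (K + 1) by rewrite !divr_gt0// ltr_wpDl.
  near \oo => m.
  have h1 : `|l - mom x (vn m) t| < d / 2.
    by near: m; apply: cvgr_dist_lt => //; exact: divr_gt0.
  have h2 : ep m < d / 2 / (K + 1) by near: m; exact: ep_cvg.
  have h3 : K * ep m <= d / 2.
    apply: (@le_trans _ _ ((K + 1) * ep m)).
      by rewrite ler_pM2r// lerDl.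
    by rewrite mulrC -ler_pdivlMr ?ltr_wpDl// ltW.
  rewrite -(subrK (mom x (vn m) t) (mom x (vn n) t)) -addrA.
  apply: (le_trans (ler_normD _ _)); rewrite distrC in h1.
  have := diff n m t Dt; rewrite mulrDr => h4.
  rewrite [d]splitr addrA; apply: lerD; last exact: ltW.
  by apply: (le_trans h4); rewrite lerD2l.
have mp : measurable_fun D p.
  apply: (measurable_fun_cvg (h := fun n => mom x (vn n))).
    by move=> n; apply: continuous_measurable_D; exact: mom_continuous.
  by move=> t Dt; rewrite /p (_ : t \in `]0, T[)//; exact: cv.
have Sp : S2 p.
  apply: (S2_bounded T0 (M := momB + K)) => // t Dt.
  have := pn 0%N t Dt; have := mom_le x t (Sn 0%N); rewrite /ep invr1 mulr1 distrC.
  move=> h1 h2; rewrite -(subrK (mom x (vn 0%N) t) (p t)) (le_trans (ler_normD _ _))//.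
  by rewrite addrC lerD.
(* The velocity whose residual would vanish if p were its momentum. *)
pose v t := c0^-1 * (p t - w t).
have Sv : S2 v by apply: S2Z; exact: S2B.
pose k n t := v t - vn n t.
have Sk n : S2 (k n) by exact: S2B.
have kE n t : k n t = c0^-1 * ((p t - mom x (vn n) t) - res w x (vn n) t).
  rewrite resE /k /v; move: (mom x (vn n) t) (p t) (w t) (vn n t) => a b c d.
  by field; rewrite gt_eqF.
(* Since k n is ((p - p_n) - r_n) / c0, this follows from (a - b)^2 <= 2 a^2 + 2 b^2, with |p - p_n|
   <= K ep n and the integral of r_n^2 at most (ep n)^2. *)
pose C := 2 / c0 ^+ 2 * (T * K ^+ 2 + 1).
have C0 : 0 <= C.
  by rewrite mulr_ge0 ?divr_ge0 ?sqr_ge0// addr_ge0// mulr_ge0 ?sqr_ge0// ltW.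
have k2 n : Int (fun t => k n t ^+ 2) <= C * ep n ^+ 2.
  have [_ Lk] := Sk n; have Sr := res_S2 x hw (Sn n); have [_ Lr] := Sr.
  apply: (@le_trans _ _ (Int (fun t => 2 / c0 ^+ 2 * ((K * ep n) ^+ 2 + res w x (vn n) t ^+ 2)))).
    have Lc := L1_cst T0 ((K * ep n) ^+ 2).
    apply: Int_le => //; first by L1tac.
    move=> t Dt; rewrite kE exprMn exprVn [2 / _]mulrC -mulrA ler_pM2l ?invr_gt0 ?exprn_gt0//.
    have h1 : (p t - mom x (vn n) t) ^+ 2 <= (K * ep n) ^+ 2.
      have Ke0 : 0 <= K * ep n by rewrite mulr_ge0// ltW.
      rewrite -(real_normK (num_real (p t - _))) ler_pXn2r ?nnegrE//.
      by rewrite distrC; exact: pn.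
    have : 0 <= ((p t - mom x (vn n) t) + res w x (vn n) t) ^+ 2 by exact: sqr_ge0.
    by rewrite sqrrD sqrrB; lra.
  rewrite IntZ; last by apply: L1D => //; exact: L1_cst.
  rewrite IntD//; last exact: L1_cst.
  rewrite Int_cst// /C -mulrA ler_wpM2l ?divr_ge0 ?sqr_ge0//.
  have := near_min_res_sqr hw (hn n); rewrite exprMn mulrDl mul1r => h.
  by apply: lerD => //; rewrite [leRHS]mulrAC [leRHS]mulrC -mulrA mulrC mulrA; lra.
have ep2 n : ep n ^+ 2 <= ep n.
  by rewrite expr2 ler_piMr ?(ltW (ep0 n))// invf_le1 ?ler1n.
have Jv : J w x v <= phi w x.
  (* [J_descent] from v_n to v takes the place of lower semicontinuity. The four coefficients come
     from the slack of [near_min], from the two halves of r k <= (r^2 + k^2) / 2, and from the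
     quadratic term; each multiplies (ep n)^2 <= ep n. *)
  apply: (@ler_addharmonic _ _ _ ((4 * curv)^-1 + 2^-1 + C / 2 + curv * C)) => n.
  rewrite -/(ep n).
  have := J_descent x hw (Sn n) (Sk n).
  rewrite (_ : (fun t => vn n t + k n t) = v); last first.
    by apply/funext => t; rewrite /k addrC subrK.
  move=> h; apply: (le_trans h).
  have [_ hJ] := hn n.
  have Sr := res_S2 x hw (Sn n); have [_ Lr] := Sr; have [_ Lk] := Sk n.
  have hrk : Int (fun t => res w x (vn n) t * k n t) <=
      Int (fun t => 2^-1 * (res w x (vn n) t ^+ 2 + k n t ^+ 2)).
    apply: Int_le; [exact: S2_mul|by L1tac|].
    move=> t _; have : 0 <= (res w x (vn n) t - k n t) ^+ 2 by exact: sqr_ge0.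
    by rewrite sqrrB; lra.
  rewrite IntZ in hrk; last by L1tac.
  rewrite IntD// in hrk.
  have hr := near_min_res_sqr hw (hn n).
  have hC : curv * Int (fun t => k n t ^+ 2) <= curv * (C * ep n ^+ 2).
    by rewrite ler_pM2l ?curv_gt0.
  have hk := k2 n.
  have h3 : ep n ^+ 2 * ((4 * curv)^-1 + 2^-1 + C / 2 + curv * C) <=
      ep n * ((4 * curv)^-1 + 2^-1 + C / 2 + curv * C).
    have c1 := curv_gt0.
    have c4 : 0 <= (4 * curv)^-1 by rewrite invr_ge0 mulr_ge0// ltW.
    rewrite ler_wpM2r//; apply: addr_ge0; last exact: mulr_ge0 (ltW c1) C0.
    by apply: addr_ge0; [apply: addr_ge0|exact: divr_ge0].
  move: hJ h3 hrk hr hC hk; clear; move: (4 * curv)^-1 curv (ep n) C => u cu e' C'.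
  move: (Int _) (Int _) (Int _) => a b c.
  by lra.
exists v.
  by split => //; apply/eqP; rewrite eq_le Jv phi_le.
apply/eqP; rewrite -subr_eq0 -normr_le0.
apply: (@ler_addharmonic _ _ _ (momB * (T + C) + 1)) => n; rewrite add0r -/(ep n).
rewrite -(subrK (mom0 x (vn n)) (mom0 x v)) -addrA mulrDl mul1r.
apply: (le_trans (ler_normD _ _)); apply: lerD => //.
apply: (le_trans (mom0_lip x Sv (Sn n))); rewrite -mulrA ler_wpM2l ?momB_ge0//.
have [_ Lk] := Sk n.
apply: (@le_trans _ _ (Int (fun t => ep n + (ep n)^-1 * k n t ^+ 2))).
  apply: Int_le; [exact: L1_norm (S2_L1 T0 (Sk n))|apply: L1D; [exact: L1_cst|exact: L1Z]|].
  move=> t _; rewrite -/(k n t) -(real_normK (num_real (k n t))); set r := `| _ |.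
  have : 0 <= (ep n - r) ^+ 2 / ep n by rewrite divr_ge0 ?sqr_ge0 ?(ltW (ep0 n)).
  have -> : (ep n - r) ^+ 2 / ep n = ep n - 2 * r + (ep n)^-1 * r ^+ 2 by field; rewrite gt_eqF.
  have : 0 <= r by exact: normr_ge0.
  by lra.
rewrite IntD//; [|exact: L1_cst|exact: L1Z].
rewrite Int_cst// IntZ// mulrDl mulrC lerD2l.
rewrite -ler_pdivlMl ?invr_gt0// invrK mulrCA -expr2.
exact: k2.
Unshelve. all: by end_near. Qed.

(** For tolerances tending to 0 the initial momenta stay in [- momB, momB], and q is one of their
    cluster points. The side condition A is trivial for existence; for [near_min_unique] it keeps
    the momenta away from a given point. *)
Lemma near_min_cluster w x (A : (R -> R) -> Prop) : S2 w ->
  (forall e, 0 < e -> exists2 v, near_min w x e v & A v) ->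
  exists q, forall e, 0 < e -> exists2 v, near_min w x e v & A v /\ `|mom0 x v - q| <= e.
Proof.
move=> hw h.
pose ep (n : nat) : R := n.+1%:R^-1.
have ep0 n : 0 < ep n by rewrite invr_gt0.
have [|vn hvn] := @choice _ _ (fun n v => near_min w x (ep n) v /\ A v).
  by move=> n; have [v h1 h2] := h _ (ep0 n); exists v.
pose qn n := mom0 x (vn n).
have qnM : \forall n \near \oo, `[- momB, momB]%classic (qn n).
  near=> n; have [[hv _] _] := hvn n.
  by rewrite /= in_itv/= -ler_norml; exact: mom0_le.
have [q [_ hq]] := @segment_compact R (- momB) momB (qn @ \oo) _ qnM.
exists q => e e0.
have hA : \forall n \near \oo, [set qn m | m in [set m | ep m < e]] (qn n).
  near=> n; exists n => //=; near: n.
  by apply: near_infty_natSinv_lt (PosNum e0).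
have [_ [[m /= me <-] hb]] := hq _ (ball q e) hA (nbhsx_ballx q e e0).
exists (vn m); have [h1 h2] := hvn m.
  by apply: near_min_le h1; rewrite (ltW (ep0 _)) ltW.
by split => //; move: hb; rewrite /ball/= distrC => /ltW.
Unshelve. all: by end_near. Qed.

Lemma minimal_exists w x : S2 w -> exists v, minimal w x v.
Proof.
move=> hw.
have [|q hq] := @near_min_cluster w x (fun=> True) hw.
  move=> e e0; have c0' : 0 < e ^+ 2 / (4 * curv).
    by rewrite divr_gt0 ?exprn_gt0// mulr_gt0 ?curv_gt0.
  by have [v hv /ltW] := phi_approx x hw c0'; exists v.
have [|v hv _] := @near_min_limit w x q hw; last by exists v.
by move=> e e0; have [v h [_ ?]] := hq e e0; exists v.
Qed.

Lemma minimal_res w x v : S2 w -> minimal w x v ->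
  Int (fun t => `|res w x v t|) = 0.
Proof.
move=> hw h; apply/eqP; rewrite eq_le Int_ge0// andbT.
apply: (@ler_addharmonic _ _ _ (T + 1)) => n; rewrite add0r mulrC.
apply: (near_min_res hw); first by rewrite invr_gt0.
exact: minimal_near_min.
Qed.

(** * Monotonicity of the initial momentum *)

(** Two-point comparison: each optimal control is tried from the other starting point. *)
Lemma minimal_mom0_mono w x y v u : S2 w -> x < y -> minimal w x v -> minimal w y u ->
  mom0 x v + 2 * momB * x <= mom0 y u + 2 * momB * y.
Proof.
move=> hw xy [hv ev] [hu eu].
have := J_shift x (y - x) hw hv; rewrite addrC subrK => h1.
have := J_shift y (x - y) hw hu; rewrite addrC subrK => h2.
have h3 := phi_le y hw hv; have h4 := phi_le x hw hu.
by move: h1 h2 h3 h4; rewrite ev eu; exact: mono_algebra.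
Qed.

Section measurable_monotone.
Variables (k f : R -> R) (C : R).
Hypothesis (C0 : 0 <= C).
Hypothesis (kf : forall x y, x <= y -> `|f x - f y| <= C * (k y - k x)).

(** [f + C k] is nondecreasing, so f is a difference of two monotone functions. *)
Lemma lip_monotone_measurable : nondecreasing_fun k -> measurable_fun setT f.
Proof.
move=> hk.
have h1 : nondecreasing_fun (fun x => f x + C * k x).
  by move=> x y xy; have := kf xy; move=> /(le_trans (ler_norm _)); lra.
have h2 : nondecreasing_fun (fun x => C * k x).
  by move=> x y xy; rewrite ler_wpM2l// hk.
rewrite (_ : f = (fun x => f x + C * k x - C * k x)); last first.
  by apply/funext => x; rewrite addrK.
by apply: measurable_funB; exact: nondecreasing_measurable.
Qed.

End measurable_monotone.

Section minimal_family.
Variables (w : R -> R) (v : R -> R -> R).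
Hypotheses (hw : S2 w) (hv : forall x, minimal w x (v x)).

Let Sv x : S2 (v x). Proof. by case: (hv x). Qed.

(** The monotone function p(0) + 2 momB x with one more x added: its increments then dominate those
    of x and of p(0) simultaneously. *)
Let k x := mom0 x (v x) + (2 * momB + 1) * x.

Let k_mono : nondecreasing_fun k.
Proof.
move=> x y; rewrite le_eqVlt => /predU1P[->//|xy]; rewrite /k.
have := minimal_mom0_mono hw xy (hv x) (hv y); have := ltW xy.
by move: (mom0 x (v x)) (mom0 y (v y)) momB => a b c; lra.
Qed.

Let k_lip x y : x <= y ->
  `|x - y| + `|mom0 x (v x) - mom0 y (v y)| <= (2 * momB + 2) * (k y - k x).
Proof.
rewrite le_eqVlt => /predU1P[->|xy]; first by rewrite !subrr normr0 mulr0 addr0.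
have := minimal_mom0_mono hw xy (hv x) (hv y); rewrite /k.
have := momB_ge0; move: momB (mom0 x (v x)) (mom0 y (v y)) => M q q' M0 h.
rewrite (ltr0_norm (_ : x - y < 0)) ?subr_lt0//.
have d0 : 0 < y - x by rewrite subr_gt0.
set d := y - x in d0; have -> : - (x - y) = d by rewrite opprB.
have -> : q' + (2 * M + 1) * y - (q + (2 * M + 1) * x) = (q' - q) + (2 * M + 1) * d.
  by rewrite /d; ring.
have {}h : 0 <= (q' - q) + 2 * M * d by move: h; rewrite /d; lra.
move: (q' - q) (d) h d0 (distrC q q') => D' d' h d0 ->.
have Md := mulr_ge0 M0 (ltW d0).
have [D0|D0] := leP 0 D'; first by rewrite ger0_norm//; nra.
by rewrite ltr0_norm//; nra.
Qed.

(** The residuals of minimizers vanish, so [stability] involves only the increments of x and p(0),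
    which k dominates. The bound allows jumps in x, and still suffices for measurability. *)
Lemma family_lip x y t : x <= y -> t \in `[0, T] ->
  `|traj x (v x) t - traj y (v y) t| + `|mom x (v x) t - mom y (v y) t| <=
  stab * (2 * momB + 2) * (k y - k x).
Proof.
move=> xy tT; apply: (le_trans (stability x y hw (Sv x) (Sv y) tT)).
rewrite -mulrA ler_wpM2l ?stab_ge0//; apply: le_trans (k_lip xy).
have r1 := S2_L1 T0 (res_S2 x hw (Sv x)); have r2 := S2_L1 T0 (res_S2 y hw (Sv y)).
suff -> : Int (fun t => `|res w x (v x) t - res w y (v y) t|) = 0 by rewrite mulr0 addr0.
apply/eqP; rewrite eq_le Int_ge0// andbT.
have n1 := L1_norm r1; have n2 := L1_norm r2.
have : Int (fun t => `|res w x (v x) t| + `|res w y (v y) t|) = 0.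
  by rewrite (IntD n1 n2) (minimal_res hw (hv x)) (minimal_res hw (hv y)) addr0.
move=> E; apply: (@le_trans _ _ (Int (fun t => `|res w x (v x) t| + `|res w y (v y) t|))).
  apply: Int_le; [exact: L1_norm (L1B r1 r2)|exact: L1D n1 n2|].
  by move=> s _; exact: ler_normB.
by rewrite E.
Qed.

(** Primitives are constant on either side of ]0,T[, so [family_lip] extends to all real times by
    clamping. *)
Let clamp t : R := Num.min (Num.max t 0) T.

Let clampP t : clamp t \in `[0, T].
Proof. by rewrite in_itv/= /clamp ge_min le_min le_max lexx orbT/= (ltW T0) lexx orbT. Qed.

Let prim_clamp (f : R -> R) t : P f t = P f (clamp t).
Proof.
rewrite /clamp; have [t0|t0] := leP t 0.
  by rewrite (min_l (ltW T0)) !prim_le0.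
by have [tT|Tt] := leP t T => //; rewrite !prim_geT// ltW.
Qed.

Lemma traj_family_measurable t : measurable_fun setT (fun x => traj x (v x) t).
Proof.
have e x : traj x (v x) t = traj x (v x) (clamp t) by rewrite trajE prim_clamp -trajE.
under eq_fun do rewrite e.
apply: (@lip_monotone_measurable k _ (stab * (2 * momB + 2))).
- by rewrite mulr_ge0 ?stab_ge0// addr_ge0// mulr_ge0 ?momB_ge0.
- move=> x y xy; apply: le_trans (family_lip xy (clampP t)).
  by rewrite lerDl.
- exact: k_mono.
Qed.

Lemma mom_family_measurable t : measurable_fun setT (fun x => mom x (v x) t).
Proof.
have e x : mom x (v x) t = mom x (v x) (clamp t) by rewrite momE prim_clamp -momE.
under eq_fun do rewrite e.
apply: (@lip_monotone_measurable k _ (stab * (2 * momB + 2))).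
- by rewrite mulr_ge0 ?stab_ge0// addr_ge0// mulr_ge0 ?momB_ge0.
- move=> x y xy; apply: le_trans (family_lip xy (clampP t)).
  by rewrite lerDr.
- exact: k_mono.
Qed.

Lemma traj_jointly_measurable : measurable_fun setT
  (fun p : measurableTypeR R * measurableTypeR R => traj p.2 (v p.2) p.1).
Proof.
apply: (@caratheodory_measurable R (fun t x => traj x (v x) t)).
- by move=> x; exact: traj_continuous.
- exact: traj_family_measurable.
Qed.

Lemma mom_jointly_measurable : measurable_fun setT
  (fun p : measurableTypeR R * measurableTypeR R => mom p.2 (v p.2) p.1).
Proof.
apply: (@caratheodory_measurable R (fun t x => mom x (v x) t)).
- by move=> x; exact: mom_continuous.
- exact: mom_family_measurable.
Qed.

End minimal_family.

(** Points with two initial momenta are countable: by monotonicity the open intervals between the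
    shifted momenta are disjoint for distinct x, and each contains a rational. By [stability], p(0)
    determines the optimal trajectory from x. *)
Lemma minimal_unique_ae w : S2 w -> {ae mu, forall x, forall v u,
  minimal w x v -> minimal w x u -> mom0 x v = mom0 x u}.
Proof.
move=> hw.
(* [G r] collects the points whose interval contains r; it has at most one element. *)
pose G (r : rat) : set R := [set x | exists v u, [/\ minimal w x v, minimal w x u,
  mom0 x v + 2 * momB * x < ratr r & ratr r < mom0 x u + 2 * momB * x]].
have G1 r x y : G r x -> G r y -> x = y.
  move=> [v [u [hv hu h1 h2]]] [v' [u' [hv' hu' h3 h4]]].
  apply/eqP; case: ltgtP => // xy.
    have := minimal_mom0_mono hw xy hu hv'.
    by move=> /(lt_le_trans h2)/lt_trans/(_ h3); rewrite ltxx.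
  have := minimal_mom0_mono hw xy hu' hv.
  by move=> /(lt_le_trans h4)/lt_trans/(_ h1); rewrite ltxx.
pose F (n : nat) : set R := if unpickle n is Some r then G r else set0.
have hF n : mu.-negligible (F n).
  rewrite /F; case: unpickle => [r|]; last exact: negligible_set0.
  have [[x0 hx0]|no] := pselect (exists x, G r x).
    exists [set x0]; split; [exact: measurable_set1|exact: lebesgue_measure_set1|].
    by move=> y /= hy; exact: G1 hy hx0.
  by apply: negligibleS (@negligible_set0 _ _ _ mu) => y hy; apply: no; exists y.
have := negligible_bigcup hF; apply: negligibleS => x /= nx.
apply: contrapT => nF; apply: nx => v u hv hu; apply/eqP; apply: contrapT => /negP ne.
have key v' u' : minimal w x v' -> minimal w x u' -> mom0 x v' < mom0 x u' -> False.
  move=> hv' hu' lt.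
  have : mom0 x v' + 2 * momB * x < mom0 x u' + 2 * momB * x by rewrite ltrD2r.
  move=> /rat_in_itvoo[r]; rewrite in_itv/= => /andP[r1 r2].
  apply: nF; exists (pickle r); first exact: Logic.I.
  rewrite /F pickleK.
  by exists v', u'; split.
by move: ne; case: ltgtP => // lt _; [exact: key hv hu lt|exact: key hu hv lt].
Qed.

(** * Velocity and derivative of a minimizer in terms of its momentum *)

Lemma minimal_res_ae w x v : S2 w -> minimal w x v ->
  {ae mu, forall t, D t -> v t = c0^-1 * (mom x v t - w t)}.
Proof.
move=> hw h; have [hv ev] := h; have hr := res_S2 x hw hv.
have r0 : Int (fun t => res w x v t ^+ 2) = 0.
  apply/eqP; rewrite eq_le Int_ge0 ?andbT; last by move=> t _; exact: sqr_ge0.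
  by apply: (le_trans (res_sqr_le x hw hv)); rewrite ev subrr mulr0.
have [N [mN N0 hN]] := Int_sqr_eq0 hr r0; exists N; split => // t /= ht.
apply: hN => /= hN; apply: ht => Dt; have := hN Dt; rewrite resE.
move: (mom x v t) (v t) (w t) => a b c e.
have -> : a = c0 * b + c by lra.
by rewrite addrK mulKf// gt_eqF.
Qed.

Lemma mom_S2 x v : S2 v -> S2 (mom x v).
Proof.
move=> hv; apply: (S2_bounded T0 (M := momB)) => [|t _]; last exact: mom_le.
exact: continuous_measurable_D (mom_continuous hv).
Qed.

(** Trades the velocity, known only off a null set that may depend on x, for the momentum, which can
    be averaged over x. *)
Lemma minimal_Int w x v h : S2 w -> S2 h -> minimal w x v ->
  Int (fun t => v t * h t) =
  c0^-1 * (Int (fun t => h t * mom x v t) - Int (fun t => h t * w t)).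
Proof.
move=> hw hh hm; have [hv _] := hm; have hp := mom_S2 x hv.
have L1' := S2_mul hh hp; have L2' := S2_mul hh hw.
rewrite -(IntB L1' L2') -(IntZ _ (L1B L1' L2')).
apply: ae_eq_Rintegral; first exact: measurable_itv.
  exact: integrable_oo_measurable (L1Z _ (L1B L1' L2')).
have [N [mN N0 hN]] := minimal_res_ae hw hm; exists N; split => // t /= ht.
apply: hN => /= hN; apply: ht => Dt; rewrite (hN Dt).
by rewrite -mulrA; congr (_ * _); rewrite mulrC mulrBr.
Qed.

Lemma minimal_traj w x v t : S2 w -> minimal w x v ->
  traj x v t = x + c0^-1 * (P (mom x v) t - P w t).
Proof.
move=> hw hm; have [hv _] := hm; have hp := S2_L1 T0 (mom_S2 x hv).
have Lw := S2_L1 T0 hw.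
rewrite trajE -(primB _ hp Lw) -(primZ _ _ (L1B hp Lw)) !primE; congr (_ + _).
apply: ae_eq_Rintegral; first exact: measurable_itv.
  exact: integrable_oo_measurable (L1_cut t (L1Z _ (L1B hp Lw))).
have [N [mN N0 hN]] := minimal_res_ae hw hm; exists N; split => // s /= hs.
by apply: hN => /= hN; apply: hs => Ds; rewrite (hN Ds).
Qed.

(** On [0,T] a minimizer equals x + c0^-1 (P p - P w) with p continuous, so its derivative is known
    at every t where P w has derivative w t. The excluded times depend on w alone, which makes the
    clearing integral over x computable at a fixed t. *)
Lemma minimal_derive w x v z t : S2 w -> minimal w x v ->
  {in `[0, T], z =1 traj x v} -> t \in `]0, T[ ->
  derivable (P w) t 1 -> derive1 (P w) t = w t ->
  derive1 z t = c0^-1 * (mom x v t - w t).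
Proof.
move=> hw hm hz tD dw ew; have [hv _] := hm.
have cp := mom_continuous (x := x) hv.
have [dp ep] := prim_derivable (S2_L1 T0 (mom_S2 x hv)) (cp t) tD.
have ip : is_derive t 1 (P (mom x v)) (mom x v t).
  by apply: DeriveDef; [exact: dp|rewrite -derive1E; exact: ep].
have iw : is_derive t 1 (P w) (w t).
  by apply: DeriveDef; [exact: dw|rewrite -derive1E; exact: ew].
rewrite derive1E (@near_eq_derive _ _ _ z (fun s => x + c0^-1 * (P (mom x v) s - P w s))).
  apply: derive_val.
  apply: is_derive_eq; rewrite /GRing.scale/=; ring.
near=> s; rewrite -(minimal_traj s hw hm); apply: hz.
apply: subset_itv_oo_cc; near: s; exact: near_in_itvoo.
Unshelve. all: by end_near. Qed.

Lemma J_price w eta x v : S2 w -> S2 eta -> S2 v ->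
  J eta x v = J w x v + Int (fun t => v t * (eta t - w t)).
Proof.
move=> hw he hv; have L' := S2_mul hv (S2B he hw).
rewrite /J addrAC -(IntD (J_L1 x hw hv) L'); congr (_ + _).
by apply: eq_Int => t _; ring.
Qed.

(** Otherwise near-minimizers of vanishing tolerance with momenta farther than d from q would have a
    cluster momentum. It belongs to a minimizer by [near_min_limit], hence equals q, contradicting
    the distance. *)
Lemma near_min_unique w x q d : S2 w -> 0 < d ->
  (forall v, minimal w x v -> mom0 x v = q) ->
  exists2 e, 0 < e & forall v, near_min w x e v -> `|mom0 x v - q| <= d.
Proof.
move=> hw d0 hq; apply: contrapT => no.
have [|q1 hq1] := @near_min_cluster w x (fun v => ~ (`|mom0 x v - q| <= d)) hw.
  move=> e e0; apply: contrapT => ne; apply: no; exists e => // v hv.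
  by apply: contrapT => h; apply: ne; exists v.
have [|v hv ev] := @near_min_limit w x q1 hw.
  by move=> e e0; have [v h [_ h']] := hq1 e e0; exists v.
have [u _ [h]] := hq1 d d0.
by rewrite -ev (hq _ hv).
Qed.

(** * Trajectories in H^1(0,T) *)

Lemma test_function_prim psi t : test_function T psi -> t \in `[0, T] ->
  psi t = P (derive1 psi) t.
Proof.
move=> [dpsi cpsi [a [b [a0 bT hpsi]]]]; rewrite in_itv/= => /andP[t0 tT].
have dF x : x \in `]0, t[ -> is_derive x 1 (fun t => psi t - P (derive1 psi) t) 0.
  rewrite in_itv/= => /andP[x0 xt].
  have xD : x \in `]0, T[ by rewrite in_itv/= x0/= (lt_le_trans xt).
  have [dp ep] := prim_derivable (continuous_L1 cpsi) (cpsi x) xD.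
  have ip : is_derive x 1 (P (derive1 psi)) (derive1 psi x).
    by apply: DeriveDef; [exact: dp|rewrite -derive1E; exact: ep].
  have ipsi : is_derive x 1 psi (derive1 psi x).
    by apply: DeriveDef; [exact: dpsi|rewrite derive1E].
  by apply: is_derive_eq; rewrite subrr.
have cpsi0 : continuous psi.
  by move=> z; apply: differentiable_continuous; apply/derivable1_diffP.
have cF := contB cpsi0 (prim_continuous (continuous_L1 cpsi)).
have psi0 : psi 0 = 0 by apply: hpsi; rewrite in_itv/= (lt_geF a0).
have [c _] := MVT_segment t0 dF (continuous_subspaceT cF).
rewrite mul0r psi0 (prim_le0 T0 _ (lexx 0)) !subr0 => /eqP.
by rewrite subr_eq0 => /eqP.
Qed.

Lemma traj_weak_derivative x v psi : S2 v -> test_function T psi ->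
  Int (fun t => traj x v t * derive1 psi t) = - Int (fun t => v t * psi t).
Proof.
move=> hv hpsi; have [_ cpsi [a [b [a0 bT psi0]]]] := hpsi.
have Lpsi := continuous_L1 cpsi; have Lv := S2_L1 T0 hv.
have Ipsi : Int (derive1 psi) = 0.
  rewrite -(prim_geT _ (lexx T)) -test_function_prim//; last by rewrite in_itv/= ltW/=.
  by apply: psi0; rewrite in_itv/= (lt_geF bT) andbF.
have Lp : L1 (fun t => derive1 psi t * P v t).
  by apply: continuous_L1; apply: contM => //; exact: prim_continuous.
transitivity (Int (fun t => x * derive1 psi t + derive1 psi t * P v t)).
  by apply: eq_Int => t _; rewrite trajE; ring.
rewrite (IntD (L1Z x Lpsi) Lp) (IntZ x Lpsi) Ipsi mulr0 add0r.
rewrite (Int_by_parts Lv Lpsi) Ipsi.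
have -> : - Int (fun t => v t * psi t) = -1 * Int (fun t => v t * psi t) by rewrite mulN1r.
rewrite -IntZ.
  apply: eq_Int => t Dt; rewrite -test_function_prim//; first by ring.
  exact: subset_itv_oo_cc.
apply: S2_mul => //; have cpsi0 : continuous psi.
  by case: hpsi => dpsi _ _ z; apply: differentiable_continuous; apply/derivable1_diffP.
split; first exact: continuous_measurable_D.
by apply: continuous_L1; exact: contX.
Qed.

Lemma traj_H1 x v : S2 v -> H1 T (traj x v) /\ traj x v 0 = x.
Proof.
move=> hv; split; last by rewrite trajE prim_le0// addr0.
split; first exact: (continuous_subspaceT (traj_continuous hv)).
exists v; first exact/S2_L2.
by move=> psi hpsi; exact: traj_weak_derivative.
Qed.

(** The primitive of f lies between 0 and the total integral 0, and its derivative on ]0,T[ is f. *)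
Lemma continuous_nonneg_Int_eq0 f : continuous f -> (forall t, 0 <= f t) ->
  Int f = 0 -> forall t, t \in `]0, T[ -> f t = 0.
Proof.
move=> cf f0 I0 t tD; have Lf := continuous_L1 cf.
have P0 : P f = fun=> 0.
  apply/funext => s; apply/eqP; rewrite eq_le; apply/andP; split.
    rewrite -I0 primE; apply: Int_le => //; first exact: L1_cut.
    by move=> r _; case: (r <= s)%R; rewrite ?mulr1 ?mulr0.
  by rewrite primE; apply: Int_ge0 => r _; rewrite mulr_ge0.
have [_ <-] := prim_derivable Lf (cf t) tD.
by rewrite P0 derive1_cst.
Qed.

Lemma prim_test_function theta a b : 0 < a -> b < T -> a <= b ->
  continuous theta -> (forall t, t \notin `[a, b] -> theta t = 0) -> Int theta = 0 ->
  test_function T (P theta) /\ derive1 (P theta) = theta.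
Proof.
move=> a0 bT ab ct th0 I0; have Lt := continuous_L1 ct.
have thD : theta \_ D = theta.
  apply/funext => t; rewrite patchE; case: ifPn => // tD; apply/esym/th0.
  apply: contra tD; rewrite in_itv/= => /andP[at_ tb]; apply/mem_set => /=.
  by rewrite in_itv/= (lt_le_trans a0 at_) (le_lt_trans tb bT).
have ti : mu.-integrable setT (EFin \o theta).
  by have := L1_restrict Lt; rewrite thD.
have E : P theta = (fun x => \int[mu]_(s in `]-oo, x]) theta s).
  by apply/funext => x; rewrite primE_Nyitv thD.
have dth t : derivable (P theta) t 1 /\ derive1 (P theta) t = theta t.
  rewrite E; apply: (@continuous_FTC1 R theta -oo%O t (t + 1)); rewrite ?ltrDl ?ltNyr//.
    by apply: integrableS ti.
  exact: ct.
have eth : derive1 (P theta) = theta by apply/funext => x; case: (dth x).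
split => //; split; first by move=> x; case: (dth x).
  by rewrite eth.
exists a, b; split => // t tab.
have [ta|ta] := ltP t a.
  rewrite primE (@eq_Int _ _ _ (fun=> 0)) ?Int_cst ?mul0r// => s _.
  have [st|st] := leP s t; last by rewrite mulr0.
  by rewrite th0 ?mul0r// in_itv/= (leNgt a) (le_lt_trans st ta).
have bt : b < t by move: tab; rewrite in_itv/= ta/= -ltNge.
rewrite primE; apply: etrans I0; apply: eq_Int => s _.
have [st|st] := leP s t; first by rewrite mulr1.
by rewrite mulr0 th0// in_itv/= negb_and -!ltNge (lt_trans bt st) orbT.
Qed.

(* du Bois-Reymond: the test function is the primitive of c^2 (W - m), where c
   is a cutoff and m is the mean of W for the weight c^2. *)
Lemma weakly_constant (W : R -> R) : continuous W ->
  (forall psi, test_function T psi -> Int (fun t => W t * derive1 psi t) = 0) ->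
  forall s t, s \in `]0, T[ -> t \in `]0, T[ -> W s = W t.
Proof.
move=> cW hW.
have main s t : 0 < s -> s <= t -> t < T -> W s = W t.
  move=> s0 st tT.
  pose a := s / 2; pose b := (t + T) / 2.
  have a0 : 0 < a by rewrite divr_gt0.
  have as_ : a < s by rewrite /a; lra.
  have tb : t < b by rewrite /b; lra.
  have bT : b < T by rewrite /b; lra.
  have ab : a <= b by lra.
  (* The cutoff is only continuous: the test function is a primitive of theta and thus still C^1. *)
  pose c r := Num.max 0 ((r - a) * (b - r)).
  have cc : continuous c.
    apply: contMax; first by move=> x; exact: cst_continuous.
    by apply: contM; apply: contB => x; (exact: cvg_id || exact: cst_continuous).
  have c0' r : r \notin `[a, b] -> c r = 0.
    rewrite in_itv/= negb_and -!ltNge => h; apply/max_idPl.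
    by case/orP: h => h; nra.
  have cpos r : a < r -> r < b -> 0 < c r.
    by move=> ar rb; rewrite /c lt_max mulr_gt0 ?orbT ?subr_gt0.
  have cc2 := contX (n := 2) cc.
  have Lc2 := continuous_L1 cc2.
  have cc2W := contM cc2 cW; have Lc2W := continuous_L1 cc2W.
  have Ic : 0 < Int (fun r => c r ^+ 2).
    rewrite lt_neqAle Int_ge0 ?andbT; last by move=> r _; exact: sqr_ge0.
    apply/eqP => /esym I0.
    have := @continuous_nonneg_Int_eq0 _ cc2 (fun r => sqr_ge0 _) I0 s.
    rewrite in_itv/= s0 (le_lt_trans st tT) => /(_ isT) /eqP.
    by rewrite sqrf_eq0 gt_eqF// cpos//; exact: le_lt_trans st tb.
  pose m := Int (fun r => c r ^+ 2 * W r) / Int (fun r => c r ^+ 2).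
  pose theta r := c r ^+ 2 * W r - m * c r ^+ 2.
  have cth : continuous theta by apply: contB => //; exact: contZ.
  have Ith : Int theta = 0.
    rewrite /theta (IntB Lc2W (L1Z m Lc2)) (IntZ m Lc2) /m divfK ?gt_eqF//.
    by rewrite subrr.
  have th0 r : r \notin `[a, b] -> theta r = 0.
    by move=> /c0' cr; rewrite /theta cr expr0n/= mul0r mulr0 subrr.
  have [tf dtf] := prim_test_function a0 bT ab cth th0 Ith.
  have := hW _ tf; rewrite dtf => IW.
  have cWth := contM cW cth; have LWth := continuous_L1 cWth; have Lth := continuous_L1 cth.
  have cf : continuous (fun r => (c r * (W r - m)) ^+ 2).
    apply: contX; apply: contM => //; apply: contB => // x; exact: cst_continuous.
  have If : Int (fun r => (c r * (W r - m)) ^+ 2) = 0.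
    (* The square is (W - m) theta. The product W theta integrates to 0 by the hypothesis on W, and
       m theta because theta has integral 0. *)
    transitivity (Int (fun r => W r * theta r - m * theta r)).
      by apply: eq_Int => r _; rewrite /theta; ring.
    by rewrite (IntB LWth (L1Z m Lth)) (IntZ m Lth) IW Ith mulr0 subrr.
  have Wm r : s <= r -> r <= t -> W r = m.
    move=> sr rt.
    have := @continuous_nonneg_Int_eq0 _ cf (fun r => sqr_ge0 _) If r.
    rewrite in_itv/= (lt_le_trans s0 sr) (le_lt_trans rt tT) => /(_ isT) /eqP.
    rewrite sqrf_eq0 mulf_eq0 gt_eqF/=; last first.
      by apply: cpos; [exact: lt_le_trans sr|exact: le_lt_trans tb].
    by rewrite subr_eq0 => /eqP.
  by rewrite !Wm.
move=> s t; rewrite !in_itv/= => /andP[s0 sT] /andP[t0 tT].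
by have [st|/ltW ts] := leP s t; [exact: main|apply/esym; exact: main].
Qed.

(** The difference W of z and the primitive of its weak derivative is weakly constant, hence
    constant on ]0,T[, and one-sided limits carry this to both endpoints. *)
Lemma H1_traj z : H1 T z -> exists2 v, S2 v & {in `[0, T], z =1 traj (z 0) v}.
Proof.
move=> [cz [v /S2_L2 hv wz]]; exists v => //.
have Lv := S2_L1 T0 hv.
(* z is continuous only within [0,T]; composing with the clamp makes it continuous on the line
   without changing it on [0,T]. *)
pose clamp t : R := Num.min (Num.max t 0) T.
have clampP t : `[0, T]%classic (clamp t).
  by rewrite /= in_itv/= /clamp ge_min le_min le_max lexx orbT/= (ltW T0) lexx orbT.
have clampE t : t \in `[0, T] -> clamp t = t.
  by rewrite in_itv/= => /andP[t0 tT]; rewrite /clamp max_l// min_l.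
have cclamp : continuous clamp.
  apply: contMin; last by move=> x; exact: cst_continuous.
  by apply: contMax => x; [exact: cvg_id|exact: cst_continuous].
have czc : continuous (z \o clamp).
  move=> t; apply: (@cvg_comp _ _ _ clamp z (nbhs t) (within `[0, T]%classic (nbhs (clamp t)))).
    move=> U hU; have := cclamp t _ hU; rewrite !nbhs_simpl/=.
    by apply: filterS => s; apply; exact: clampP.
  have /subspace_continuousP := cz; apply; exact: clampP.
pose W t := z (clamp t) - P v t.
have cW : continuous W by apply: contB => //; exact: prim_continuous.
have Wpsi psi : test_function T psi -> Int (fun t => W t * derive1 psi t) = 0.
  move=> hpsi; have [_ cpsi _] := hpsi.
  have h1 := wz psi hpsi; have h2 := traj_weak_derivative 0 hv hpsi.
  have L1' := continuous_L1 (contM czc cpsi).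
  have L2' := continuous_L1 (contM (traj_continuous (x := 0) hv) cpsi).
  transitivity (Int (fun t => z (clamp t) * derive1 psi t - traj 0 v t * derive1 psi t)).
    by apply: eq_Int => t _; rewrite /W trajE add0r mulrBl.
  rewrite (IntB L1' L2') h2 (_ : Int (fun t => z (clamp t) * derive1 psi t) =
    - Int (fun t => v t * psi t)); first by rewrite subrr.
  rewrite -h1; apply: eq_Int => t Dt; rewrite clampE//.
  exact: subset_itv_oo_cc.
have Wc := weakly_constant cW Wpsi.
pose h : R := T / 2.
have hD : h \in `]0, T[ by rewrite in_itv/= /h divr_gt0//= ltr_pdivrMr// mulr_natr mulr2n ltrDl.
have W0 : W 0 = W h.
  have h1 : W t @[t --> 0^'+] --> W 0 by apply: cvg_at_right_filter; exact: cW.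
  have h2 : W t @[t --> 0^'+] --> W h.
    apply: cvg_near_cst; near=> t; apply: Wc => //; rewrite in_itv/=; apply/andP; split.
      by near: t; exact: nbhs_right_gt.
    by near: t; exact: nbhs_right_lt.
  exact: (cvg_unique _ h1 h2).
have WT : W T = W h.
  have h1 : W t @[t --> T^'-] --> W T by apply: cvg_at_left_filter; exact: cW.
  have h2 : W t @[t --> T^'-] --> W h.
    apply: cvg_near_cst; near=> t; apply: Wc => //; rewrite in_itv/=; apply/andP; split.
      by near: t; exact: nbhs_left_gt.
    by near: t; exact: nbhs_left_lt.
  exact: (cvg_unique _ h1 h2).
have z0 : z 0 = W h.
  by rewrite -W0 /W clampE ?prim_le0 ?subr0// in_itv/= lexx ltW.
move=> t tT; rewrite trajE z0.
suff <- : W t = W h by rewrite /W clampE// subrK.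
move: tT; rewrite in_itv/= le_eqVlt => /andP[/predU1P[<-//|t0]].
by rewrite le_eqVlt => /predU1P[->//|tT]; apply: Wc; rewrite // in_itv/= t0.
Unshelve. all: by end_near. Qed.

(** * From the reduced functional back to the control problem *)

Lemma cost_traj w x v z : S2 w -> S2 v -> {in `[0, T], z =1 traj x v} ->
  cost T c0 V g w z = J w x v.
Proof.
move=> hw hv hz; rewrite /cost /J hz ?in_itv/= ?lexx ?(ltW T0)//; congr (_ + _).
(* [derive1 z] agrees with v only almost everywhere, by Lebesgue differentiation, and its
   measurability is not known. *)
apply: ae_eq_Rintegral; first exact: measurable_itv.
  exact: integrable_oo_measurable (J_L1 x hw hv).
have [N [mN N0 hN]] := prim_derivable_ae (S2_L1 T0 hv); exists N; split => // t /= ht.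
apply: hN => /= hN; apply: ht => Dt; have tD : t \in `]0, T[ by [].
have [dv ev] := hN tD.
rewrite hz; last exact: subset_itv_oo_cc.
suff -> : derive1 z t = v t by [].
rewrite derive1E (@near_eq_derive _ _ _ z (fun s => x + P v s)).
  have iv : is_derive t 1 (P v) (v t).
    by apply: DeriveDef; [exact: dv|rewrite -derive1E; exact: ev].
  have := is_deriveD (is_derive_cst x t 1) iv; rewrite add0r => ixv.
  exact: (@derive_val _ _ _ _ _ _ _ ixv).
near=> s; rewrite hz ?trajE//.
apply: subset_itv_oo_cc; near: s; exact: near_in_itvoo.
Unshelve. all: by end_near. Qed.

Lemma value_phi w x : S2 w -> value T c0 V g w x = phi w x.
Proof.
move=> hw; rewrite /value /phi; congr inf; apply/seteqP; split => r /=.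
  move=> [z [hz z0] <-]; have [v hv zv] := H1_traj hz.
  by exists v => //; rewrite z0 in zv; rewrite (cost_traj hw hv zv).
move=> [v hv <-]; exists (traj x v); first exact: traj_H1.
by rewrite (cost_traj (x := x) (v := v)).
Qed.

Lemma minimizerP w x z : S2 w -> minimizer T c0 V g w x z <->
  H1 T z /\ exists2 v, minimal w x v & {in `[0, T], z =1 traj x v}.
Proof.
move=> hw; split.
  move=> [[hz z0] zmin]; split => //; have [v hv zv] := H1_traj hz.
  rewrite z0 in zv; exists v => //; split => //.
  apply/eqP; rewrite eq_le phi_le// andbT; apply: phi_ge => u hu.
  rewrite -(cost_traj hw hv zv) -(cost_traj (x := x) (v := u) (z := traj x u) hw hu)//.
  by apply: zmin; exact: traj_H1.
move=> [hz [v [hv ev] zv]].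
have z0 : z 0 = x.
  by rewrite zv ?in_itv/= ?lexx ?(ltW T0)// trajE prim_le0// addr0.
split => // y [hy y0]; have [u hu yu] := H1_traj hy; rewrite y0 in yu.
by rewrite (cost_traj hw hv zv) (cost_traj hw hu yu) ev phi_le.
Qed.

(** * Market clearing and the dual functional *)

Section population.
Variables rho Q : R -> R.
Hypotheses (mrho : measurable_fun setT rho) (rho_ge0 : forall x, 0 <= rho x).
Hypothesis rho1 : (\int[mu]_x (rho x)%:E = 1)%E.
Hypothesis rho_supp : compactly_supported rho.
Hypothesis hQ : S2 Q.
Local Notation RI f := (mu.-integrable setT (EFin \o f)).

Lemma rho_integrable : RI rho.
Proof.
apply/integrableP; split; first exact/measurable_EFinP.
under eq_integral => x _ do rewrite /= ger0_norm//.
by rewrite rho1 ltry.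
Qed.

Lemma Rintegral_rho : \int[mu]_x rho x = 1.
Proof. by rewrite /Rintegral rho1. Qed.

Lemma weighted_integrable f C : 0 <= C -> measurable_fun setT f ->
  {ae mu, forall x, `|f x * rho x| <= C * rho x} -> RI (fun x => f x * rho x).
Proof.
move=> C0 mf hf; apply/integrableP; split.
  by apply/measurable_EFinP; exact: measurable_funM.
have : (\int[mu]_x `|(C * rho x)%:E| < +oo)%E.
  by have /integrableP[_] := integrableZl measurableT C rho_integrable.
apply: le_lt_trans; apply: ae_ge0_le_integral => //=.
- by apply/measurable_EFinP; apply: measurableT_comp => //; exact: measurable_funM.
- by apply/measurable_EFinP; apply: measurableT_comp => //; exact: measurable_funM.
- apply: ae_imp hf => x hx _; rewrite lee_fin (le_trans hx)//.
  exact: ler_norm.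
Qed.

(** The value is Lipschitz in x, hence bounded on the compact set that carries rho; this is where
    the compact support enters. *)
Lemma phi_integrable w : S2 w -> RI (fun x => phi w x * rho x).
Proof.
move=> hw; have [K cK hK] := rho_supp.
have [M [_ hM]] := compact_bounded cK.
have {}hM x : K x -> `|x| <= `|M| + 1.
  move=> Kx; apply: (hM (`|M| + 1)) => //.
  by rewrite (le_lt_trans (ler_norm M))// ltrDl.
apply: (@weighted_integrable _ (`|phi w 0| + momB * (`|M| + 1))).
- by rewrite addr_ge0// mulr_ge0 ?momB_ge0// addr_ge0.
- apply: continuous_measurable_fun; apply: (@lip_continuous _ (momB + 1)).
    by rewrite ltr_wpDl// momB_ge0.
  move=> y z; rewrite (le_trans (phi_lip _ _ hw))// ler_wpM2r// lerDl//.
apply: ae_imp hK => x hx; have [Kx|nK] := pselect (K x); last first.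
  by rewrite hx// !mulr0 normr0.
rewrite normrM (ger0_norm (rho_ge0 x)) ler_wpM2r//.
rewrite -(subrK (phi w 0) (phi w x)) addrC (le_trans (ler_normD _ _))// lerD2l.
rewrite (le_trans (phi_lip _ _ hw))// subr0 ler_wpM2l ?momB_ge0//.
exact: hM.
Qed.

Definition mean_mom (v : R -> R -> R) t : R := \int[mu]_x (rho x * mom x (v x) t).

Section family.
Variables (w : R -> R) (v : R -> R -> R).
Hypotheses (hw : S2 w) (hv : forall x, minimal w x (v x)).

Let mK : measurable_fun setT
  (fun p : measurableTypeR R * measurableTypeR R => mom p.1 (v p.1) p.2).
Proof. exact: (measurableT_comp (mom_jointly_measurable hw hv) (@measurable_swap _ _ _ _)). Qed.

Let KM (p : measurableTypeR R * measurableTypeR R) : `|mom p.1 (v p.1) p.2| <= momB.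
Proof. by case: (hv p.1) => S _; exact: mom_le. Qed.

Lemma mom_pairing_integrable h : S2 h ->
  RI (fun x => rho x * Int (fun t => h t * mom x (v x) t)).
Proof.
move=> hh; have := kernel_integrable rho_integrable (L1_restrict (S2_L1 T0 hh)) mK KM.
by under eq_fun do rewrite Int_restrictM.
Qed.

Lemma mom_pairing_fubini h : S2 h ->
  \int[mu]_x (rho x * Int (fun t => h t * mom x (v x) t)) =
  Int (fun t => h t * mean_mom v t).
Proof.
move=> hh.
have E := Rfubini_kernel rho_integrable (L1_restrict (S2_L1 T0 hh)) mK KM.
transitivity (\int[mu]_x (rho x * \int[mu]_t ((h \_ D) t * mom x (v x) t))).
  by apply: eq_Rintegral => x _; rewrite Int_restrictM.
apply: (etrans E); exact: (Int_restrictM _ h (mean_mom v)).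
Qed.

Lemma mom_integrable t : RI (fun x => rho x * mom x (v x) t).
Proof.
under eq_fun do rewrite mulrC.
apply: (@weighted_integrable _ momB); first exact: momB_ge0.
  exact: (mom_family_measurable hw hv).
apply/aeW => x; rewrite normrM (ger0_norm (rho_ge0 x)) ler_wpM2r//.
by case: (hv x) => S _; exact: mom_le.
Qed.

Lemma mean_mom_S2 : S2 (mean_mom v).
Proof.
have Sv x : S2 (v x) by case: (hv x).
apply: (S2_bounded T0 (M := momB)).
  (* Measurability of the mean in t: Fubini with time as outer variable, weighted by the constant 1
     on ]0,T[. *)
  have := kernel_integrable (L1_restrict (L1_cst T0 1)) rho_integrable
    (mom_jointly_measurable hw hv) (fun p => KM (p.2, p.1)).
  rewrite restrictM => /integrableP[/measurable_EFinP mm _].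
  have : measurable_fun D (fun t => 1 * mean_mom v t).
    by apply/(measurable_restrictT _ _).2 => //; exact: mm.
  by apply: eq_measurable_fun => t _; rewrite mul1r.
move=> t _; rewrite /mean_mom.
have hi := mom_integrable t.
rewrite (le_trans (le_normr_Rintegral _ hi))//.
have -> : momB = \int[mu]_x (momB * rho x).
  by rewrite RintegralZl// ?Rintegral_rho ?mulr1//; exact: rho_integrable.
apply: le_Rintegral => //; first exact: integrable_norm.
  exact: (integrableZl measurableT momB rho_integrable).
by move=> x _; rewrite normrM (ger0_norm (rho_ge0 x)) mulrC ler_wpM2r// mom_le.
Qed.

End family.

Definition reduced_dual w : R :=
  Int (fun t => Q t * w t) - \int[mu]_x (phi w x * rho x).

(** Supergradient inequality: at the price eta, the minimizers for w cost phi_w(x) plus the pairing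
    of their velocity with eta - w. Clearing makes the mean velocity equal to Q, so the average of
    phi_eta exceeds that of phi_w by at most the pairing of Q with eta - w. *)
Lemma reduced_clearing_min w (v : R -> R -> R) eta : S2 w -> S2 eta -> (forall x, minimal w x (v x)) ->
  {ae mu, forall t, D t -> mean_mom v t = c0 * Q t + w t} ->
  reduced_dual w <= reduced_dual eta.
Proof.
move=> hw he hv hm; pose h t := eta t - w t.
have hh : S2 h by exact: S2B.
set b := Int (fun t => h t * w t).
pose A x := Int (fun t => h t * mom x (v x) t).
have LhQ := S2_mul hh hQ; have Lhw := S2_mul hh hw.
have hphi x : phi eta x <= phi w x + c0^-1 * (A x - b).
  have [hvx ex] := hv x; apply: (le_trans (phi_le x he hvx)).
  rewrite (J_price x hw he hvx) ex lerD2l.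
  by rewrite (minimal_Int hw hh (hv x)).
have iA : RI (fun x => rho x * A x) by exact: (mom_pairing_integrable hw hv hh).
have EA : \int[mu]_x (rho x * A x) = c0 * Int (fun t => h t * Q t) + b.
  rewrite (mom_pairing_fubini hw hv hh) -(IntZ c0 LhQ) -(IntD (L1Z c0 LhQ) Lhw).
  apply: ae_eq_Rintegral; first exact: measurable_itv.
    exact: integrable_oo_measurable (L1D (L1Z c0 LhQ) Lhw).
  case: hm => N [mN N0 hN]; exists N; split => // t /= ht.
  by apply: hN => /= hN; apply: ht => Dt; rewrite (hN Dt); ring.
have iw := phi_integrable hw; have ie := phi_integrable he.
have iA' : RI (fun x => c0^-1 * (rho x * A x)) by exact: (integrableZl measurableT _ iA).
have ib : RI (fun x => (c0^-1 * b) * rho x) by exact: (integrableZl measurableT _ rho_integrable).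
have iAb : RI (fun x => c0^-1 * (rho x * A x) - (c0^-1 * b) * rho x).
  exact: (integrableB measurableT iA' ib).
have main : \int[mu]_x (phi eta x * rho x) <= \int[mu]_x (phi w x * rho x)
    + (c0^-1 * (c0 * Int (fun t => h t * Q t) + b) - c0^-1 * b).
  rewrite -EA -(RintegralZl _ _ iA)// -[X in _ <= _ + (_ - X)]mulr1 -Rintegral_rho.
  rewrite -(RintegralZl _ _ rho_integrable)// -(RintegralB _ iA' ib)// -(RintegralD _ iw iAb)//.
  apply: le_Rintegral => //; first exact: (integrableD measurableT iw iAb).
  move=> x _; rewrite (_ : _ + _ = (phi w x + c0^-1 * (A x - b)) * rho x); last by ring.
  by rewrite ler_wpM2r.
have e1 : Int (fun t => h t * Q t) = Int (fun t => Q t * eta t) - Int (fun t => Q t * w t).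
  rewrite -(IntB (S2_mul hQ he) (S2_mul hQ hw)); apply: eq_Int => t _.
  by rewrite /h; ring.
have st (X b' : R) : c0^-1 * (c0 * X + b') - c0^-1 * b' = X.
  by rewrite -mulrBr addrK mulKf// gt_eqF.
move: main; rewrite st e1 /reduced_dual.
move: (Int (fun t => Q t * eta t)) (Int (fun t => Q t * w t)) => i1 i2.
move: (\int[mu]_x (phi eta x * rho x)) (\int[mu]_x (phi w x * rho x)) => i3 i4.
lra.
Qed.

(** The cost is affine in the price and the pairings with eta are bounded, so the minimizer for w +
    s eta is near-minimal for w with excess of order s. Uniqueness of p(0) at x then forces its
    initial momentum, and by [stability] its whole momentum, to converge. *)
Lemma minimal_price_limit w (v : R -> R -> R) eta (u : nat -> R -> R -> R) x :
  S2 w -> S2 eta -> (forall x, minimal w x (v x)) ->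
  (forall n x, minimal (fun t => w t + n.+1%:R^-1 * eta t) x (u n x)) ->
  (forall v', minimal w x v' -> mom0 x v' = mom0 x (v x)) ->
  Int (fun t => eta t * mom x (u n x) t) @[n --> \oo] -->
  Int (fun t => eta t * mom x (v x) t).
Proof.
move=> hw he hv hu hx.
pose s n : R := n.+1%:R^-1.
have s0 n : 0 < s n by rewrite invr_gt0.
have s1 n : s n <= 1 by rewrite invf_le1 ?ler1n.
have hwn n : S2 (fun t => w t + s n * eta t) by apply: S2D => //; exact: S2Z.
have Su n : S2 (u n x) by case: (hu n x).
have [Svx ex] := hv x.
set I1 := Int (fun t => `|eta t|).
have Le := L1_norm (S2_L1 T0 he); have [_ Le2] := he.
have I10 : 0 <= I1 by exact: Int_ge0.
set I2 := Int (fun t => eta t ^+ 2).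
have I20 : 0 <= I2 by apply: Int_ge0 => t _; exact: sqr_ge0.
have pair_le u' : S2 u' -> `|Int (fun t => eta t * mom x u' t)| <= momB * I1.
  move=> hu'; rewrite /I1 -(IntZ momB Le); apply: Int_norm_le.
  - exact: S2_mul he (mom_S2 x hu').
  - exact: L1Z.
  - by move=> t _; rewrite normrM mulrC ler_wpM2r// mom_le.
pose A' n := Int (fun t => eta t * mom x (u n x) t).
pose A0 := Int (fun t => eta t * mom x (v x) t).
set b := Int (fun t => eta t * w t).
have Euv n : Int (fun t => u n x t * eta t) = c0^-1 * (A' n - (b + s n * I2)).
  rewrite (minimal_Int (hwn n) he (hu n x)); congr (_ * (_ - _)).
  rewrite /b /I2 -(IntZ (s n) Le2) -(IntD (S2_mul he hw) (L1Z (s n) Le2)).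
  by apply: eq_Int => t _; ring.
have Ev : Int (fun t => v x t * eta t) = c0^-1 * (A0 - b).
  exact: (minimal_Int hw he (hv x)).
(* Bounds the difference of the pairings of eta with the two velocities: each momentum pairing is at
   most momB I1 in absolute value, and s n <= 1. *)
pose C := c0^-1 * (2 * momB * I1 + I2).
have C0 : 0 <= C.
  rewrite mulr_ge0 ?invr_ge0 ?(ltW c0_gt0)//; apply: addr_ge0 => //.
  by rewrite mulr_ge0// mulr_ge0// momB_ge0.
have Jn n : J w x (u n x) <= phi w x + s n * C.
  have Jp u' : S2 u' -> J (fun t => w t + s n * eta t) x u' =
      J w x u' + s n * Int (fun t => u' t * eta t).
    move=> hu'; rewrite (J_price x hw (hwn n) hu') -(IntZ (s n) (S2_mul hu' he)).
    by congr (_ + _); apply: eq_Int => t _; ring.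
  have := phi_le x (hwn n) Svx; have [_ eu] := hu n x.
  rewrite -eu !Jp// ex Euv Ev => h.
  have hA := pair_le _ Svx; have hB := pair_le _ (Su n).
  rewrite -/A0 in hA; rewrite -/(A' n) in hB.
  have key : c0^-1 * (A0 - b) - c0^-1 * (A' n - (b + s n * I2)) <= C.
    rewrite -mulrBr /C ler_pM2l ?invr_gt0//.
    have : s n * I2 <= I2 by rewrite ler_piMl.
    by move: hA hB => /(le_trans (ler_norm _)) hA; rewrite ler_norml => /andP[hB _]; lra.
  have := ler_wpM2l (ltW (s0 n)) key; rewrite mulrBr.
  exact: descent_algebra h.
apply/cvgrPdist_lt => e e0.
set K := stab * (1 + c0^-1 * (T + 1)).
have K0 : 0 <= K.
  by rewrite mulr_ge0 ?stab_ge0// addr_ge0// mulr_ge0 ?invr_ge0 ?addr_ge0 ?ltW.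
have KI : 0 < K * 2 * I1 + 1.
  by rewrite ltr_wpDl//; exact: mulr_ge0 (mulr_ge0 K0 (ler0n _ 2)) I10.
(* Near-minimizers of tolerance d whose initial momenta are within d of that of [v x] have momenta
   within 2 K d of it, so the pairings differ by at most 2 K d I1 < e. *)
pose d := e / (K * 2 * I1 + 1).
have d0 : 0 < d by rewrite divr_gt0.
have [e1 e10 he1] := near_min_unique hw d0 hx.
pose e2 := Num.min d e1.
have e20 : 0 < e2 by rewrite lt_min d0 e10.
have c1 := curv_gt0.
have e3 : 0 < e2 ^+ 2 / (4 * curv) / (C + 1).
  by rewrite !divr_gt0 ?exprn_gt0 ?mulr_gt0// ltr_wpDl.
near=> n.
have sn : s n < e2 ^+ 2 / (4 * curv) / (C + 1).
  by near: n; apply: near_infty_natSinv_lt (PosNum e3).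
have nm : near_min w x e2 (u n x).
  split => //; apply: (le_trans (Jn n)); rewrite lerD2l.
  apply: (@le_trans _ _ (s n * (C + 1))); first by rewrite ler_pM2l// lerDl.
  by rewrite -ler_pdivlMr ?ltr_wpDl// ltW.
have nm1 : near_min w x e1 (u n x).
  by apply: near_min_le nm; rewrite (ltW e20) ge_min lexx orbT.
have nmd : near_min w x d (u n x).
  by apply: near_min_le nm; rewrite (ltW e20) ge_min lexx.
have q1 := he1 _ nm1.
have q2 : `|mom0 x (v x) - mom0 x (v x)| <= d by rewrite subrr normr0 ltW.
have Lm := S2_mul he (mom_S2 x Svx); have Lmn := S2_mul he (mom_S2 x (Su n)).
have L' := L1Z (K * (d + d)) Le.
rewrite -/A0 -(IntB Lm Lmn).
apply: (@le_lt_trans _ _ (K * (d + d) * I1)).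
  rewrite /I1 -(IntZ _ Le); apply: Int_norm_le => //; first exact: L1B Lm Lmn.
  move=> t Dt; rewrite -mulrBr normrM mulrC ler_wpM2r//.
  apply: (near_min_diff hw d0 d0 (minimal_near_min d (hv x)) nmd q2 q1).
  exact: subset_itv_oo_cc.
have -> : K * (d + d) * I1 = e * ((K * 2 * I1) / (K * 2 * I1 + 1)).
  by rewrite /d; field; rewrite gt_eqF.
by rewrite -[ltRHS]mulr1 ltr_pM2l// ltr_pdivrMr// mul1r ltrDl.
Unshelve. all: by end_near. Qed.

(** Minimality calls for a lower bound on phi at the perturbed price, while trying the fixed
    minimizer v gives only an upper one. Its own minimizer u_n, tried at the price w, gives phi_w
    plus s times the pairing of u_n with eta. The resulting inequality thus involves the moving
    minimizers, and their momenta have to be passed to the limit. *)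
Lemma reduced_min_clearing w (v : R -> R -> R) : S2 w -> (forall x, minimal w x (v x)) ->
  (forall eta, S2 eta -> reduced_dual w <= reduced_dual eta) ->
  {ae mu, forall t, D t -> mean_mom v t = c0 * Q t + w t}.
Proof.
move=> hw hv hmin.
have Sm := mean_mom_S2 hw hv.
have key eta : S2 eta -> Int (fun t => eta t * mean_mom v t) <=
    c0 * Int (fun t => Q t * eta t) + Int (fun t => eta t * w t).
  move=> he; have [_ Le2] := he.
  pose s n : R := n.+1%:R^-1.
  have s0 n : 0 < s n by rewrite invr_gt0.
  have hwn n : S2 (fun t => w t + s n * eta t) by apply: S2D => //; exact: S2Z.
  have hex n : exists u : R -> R -> R, forall x, minimal (fun t => w t + s n * eta t) x (u x).
    by have [u hu] := choice (fun x => minimal_exists x (hwn n)); exists u.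
  have [u hu] := choice hex.
  set I2 := Int (fun t => eta t ^+ 2); set b := Int (fun t => eta t * w t).
  have I20 : 0 <= I2 by apply: Int_ge0 => t _; exact: sqr_ge0.
  pose A n x := Int (fun t => eta t * mom x (u n x) t).
  pose A0 x := Int (fun t => eta t * mom x (v x) t).
  have iA n : RI (fun x => rho x * A n x) by exact: (mom_pairing_integrable (hwn n) (hu n) he).
  have iA0 : RI (fun x => rho x * A0 x) by exact: (mom_pairing_integrable hw hv he).
  have bound n : \int[mu]_x (rho x * A n x) <= c0 * Int (fun t => Q t * eta t) + b + s n * I2.
    have hphi x : phi w x + s n * (c0^-1 * (A n x - (b + s n * I2))) <=
        phi (fun t => w t + s n * eta t) x.
      have [Su eu] := hu n x; rewrite -eu (J_price x hw (hwn n) Su).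
      rewrite (_ : Int _ = s n * (c0^-1 * (A n x - (b + s n * I2)))).
        by rewrite lerD2r; exact: phi_le.
      have -> : Int (fun t => u n x t * (w t + s n * eta t - w t)) =
          s n * Int (fun t => u n x t * eta t).
        by rewrite -(IntZ (s n) (S2_mul Su he)); apply: eq_Int => t _; ring.
      rewrite (minimal_Int (hwn n) he (hu n x)); congr (_ * (_ * (_ - _))).
      rewrite /b /I2 -(IntZ (s n) Le2) -(IntD (S2_mul he hw) (L1Z (s n) Le2)).
      by apply: eq_Int => t _; ring.
    have iw := phi_integrable hw; have iwn := phi_integrable (hwn n).
    set a := s n * c0^-1.
    have a0 : 0 < a by rewrite mulr_gt0 ?invr_gt0.
    have i1 : RI (fun x => a * (rho x * A n x)) by exact: (integrableZl measurableT _ (iA n)).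
    have i2 : RI (fun x => (a * (b + s n * I2)) * rho x).
      exact: (integrableZl measurableT _ rho_integrable).
    have i12 : RI (fun x => a * (rho x * A n x) - (a * (b + s n * I2)) * rho x).
      exact: (integrableB measurableT i1 i2).
    have : \int[mu]_x (phi w x * rho x) + (a * \int[mu]_x (rho x * A n x) - a * (b + s n * I2)) <=
        \int[mu]_x (phi (fun t => w t + s n * eta t) x * rho x).
      rewrite -[X in _ + (_ - X) <= _]mulr1 -Rintegral_rho.
      rewrite -(RintegralZl _ _ (iA n))// -(RintegralZl _ _ rho_integrable)//.
      rewrite -(RintegralB _ i1 i2)// -(RintegralD _ iw i12)//.
      apply: le_Rintegral => //; first exact: (integrableD measurableT iw i12).
      move=> x _.
      rewrite [leLHS](_ : _ = (phi w x + s n * (c0^-1 * (A n x - (b + s n * I2)))) * rho x).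
        exact: ler_wpM2r.
      rewrite /a; move: (phi w x) (A n x) (s n) (rho x) => a1 a2 a3 a4; ring.
    have := hmin _ (hwn n); rewrite /reduced_dual.
    have -> : Int (fun t => Q t * (w t + s n * eta t)) =
        Int (fun t => Q t * w t) + s n * Int (fun t => Q t * eta t).
      rewrite -(IntZ (s n) (S2_mul hQ he)).
      rewrite -(IntD (S2_mul hQ hw) (L1Z (s n) (S2_mul hQ he))).
      by apply: eq_Int => t _; ring.
    move: (\int[mu]_x (phi _ x * rho x)) => p1; move: (\int[mu]_x (phi _ x * rho x)) => p2.
    move: (\int[mu]_x _) (Int (fun t => Q t * w t)) (Int (fun t => Q t * eta t)) => r i j h1 h2.
    have h3 : a * (r - (b + s n * I2)) <= a * (c0 * j).
      have -> : a * (c0 * j) = s n * j by rewrite /a -mulrA mulKf// gt_eqF.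
      by move: h1 h2; rewrite mulrBr; lra.
    by move: h3; rewrite ler_pM2l//; lra.
  have cvgA : \int[mu]_x (rho x * A n x) @[n --> \oo] --> \int[mu]_x (rho x * A0 x).
    set I1 := Int (fun t => `|eta t|).
    have Le := L1_norm (S2_L1 T0 he).
    have pair_le x u' : S2 u' -> `|Int (fun t => eta t * mom x u' t)| <= momB * I1.
      move=> hu'; rewrite /I1 -(IntZ momB Le); apply: Int_norm_le.
      - exact: S2_mul he (mom_S2 x hu').
      - exact: L1Z.
      - by move=> t _; rewrite normrM mulrC ler_wpM2r// mom_le.
    have [] := @dominated_convergence _ _ _ mu setT measurableT
      (fun n x => (rho x * A n x)%:E) (fun x => (rho x * A0 x)%:E)
      (fun x => (momB * I1 * rho x)%:E).
    - by move=> n; have /integrableP[] := iA n.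
    - by have /integrableP[] := iA0.
    (* Pointwise convergence is available exactly where p(0) is known to be unique. *)
    - have := minimal_unique_ae hw; apply: ae_imp => x hx _.
      apply: cvg_EFin; first by apply: nearW => n.
      apply: cvgM; first exact: cvg_cst.
      apply: (@minimal_price_limit w v eta u x hw he hv hu) => v' h.
      exact: hx _ _ h (hv x).
    - exact: (integrableZl measurableT _ rho_integrable).
    - apply/aeW => x n _; rewrite lee_fin normrM (ger0_norm (rho_ge0 x)) mulrC ler_wpM2r//.
      by apply: pair_le; case: (hu n x).
    move=> _ _ h; apply: fine_cvg; rewrite /Rintegral fineK//.
    exact: integrable_fin_num.
  rewrite -(mom_pairing_fubini hw hv he) -/b.
  apply/ler_addgt0Pr => e e0.
  have e1 : 0 < e / 2 / (I2 + 1) by rewrite !divr_gt0// ltr_wpDl.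
  near \oo => n.
  have h1 : `|\int[mu]_x (rho x * A0 x) - \int[mu]_x (rho x * A n x)| < e / 2.
    by near: n; apply: cvgr_dist_lt => //; exact: divr_gt0.
  have h2 : s n < e / 2 / (I2 + 1).
    by near: n; apply: near_infty_natSinv_lt (PosNum e1).
  have h3 : s n * I2 <= e / 2.
    apply: (@le_trans _ _ (s n * (I2 + 1))); first by rewrite ler_pM2l// lerDl.
    by rewrite -ler_pdivlMr ?ltr_wpDl// ltW.
  exact: limit_algebra h1 (bound n) h3.
pose f t := mean_mom v t - (c0 * Q t + w t).
have Sf : S2 f by apply: S2B => //; apply: S2D => //; exact: S2Z.
have f0 : Int (fun t => f t ^+ 2) = 0.
  apply/eqP; rewrite eq_le Int_ge0 ?andbT; last by move=> t _; exact: sqr_ge0.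
  have := key f Sf.
  have Lm := S2_mul Sf Sm; have LQ := S2_mul hQ Sf; have Lw := S2_mul Sf hw.
  have -> : Int (fun t => f t ^+ 2) = Int (fun t => f t * mean_mom v t) -
      (c0 * Int (fun t => Q t * f t) + Int (fun t => f t * w t)).
    rewrite -(IntZ c0 LQ) -(IntD (L1Z c0 LQ) Lw) -(IntB Lm (L1D (L1Z c0 LQ) Lw)).
    by apply: eq_Int => t _; rewrite expr2 {2}/f; ring.
  by rewrite subr_le0.
have [N [mN N0 hN]] := Int_sqr_eq0 Sf f0; exists N; split => // t /= ht.
by apply: hN => /= hN; apply: ht => Dt; apply/eqP; rewrite -subr_eq0; apply/eqP; exact: hN.
Unshelve. all: by end_near. Qed.

(** * Market clearing as an equation for the mean momentum *)

Lemma mean_trading_rate w (v : R -> R -> R) z : S2 w -> (forall x, minimal w x (v x)) ->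
  (forall x, {in `[0, T], z ^~ x =1 traj x (v x)}) ->
  {ae mu, forall t, t \in `]0, T[ ->
    \int[mu]_x (trading_rate z x t * rho x) = c0^-1 * (mean_mom v t - w t)}.
Proof.
move=> hw hv hz; apply: ae_imp (prim_derivable_ae (S2_L1 T0 hw)) => t ht tD.
have [dw ew] := ht tD.
have i1 : RI (fun x => c0^-1 * (rho x * mom x (v x) t)).
  exact: (integrableZl measurableT _ (mom_integrable hw hv t)).
have i2 : RI (fun x => (c0^-1 * w t) * rho x).
  exact: (integrableZl measurableT _ rho_integrable).
transitivity (\int[mu]_x (c0^-1 * (rho x * mom x (v x) t) - (c0^-1 * w t) * rho x)).
  apply: eq_Rintegral => x _.
  by rewrite /trading_rate (minimal_derive hw (hv x) (hz x) tD dw ew); ring.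
rewrite (RintegralB _ i1 i2)// (RintegralZl _ _ (mom_integrable hw hv t))//.
by rewrite (RintegralZl _ _ rho_integrable)// Rintegral_rho mulr1 mulrBr.
Qed.

Lemma market_clearingP w (v : R -> R -> R) z : S2 w -> (forall x, minimal w x (v x)) ->
  (forall x, {in `[0, T], z ^~ x =1 traj x (v x)}) ->
  market_clearing T rho Q z <-> {ae mu, forall t, D t -> mean_mom v t = c0 * Q t + w t}.
Proof.
move=> hw hv hz; have hm := mean_trading_rate hw hv hz.
have c0n : c0 != 0 by rewrite gt_eqF.
split=> [mc|mc].
  apply: (ae_imp _ (aeI hm mc)) => t [h1 h2] Dt.
  have tD : t \in `]0, T[ by [].
  by rewrite -(h2 tD) (h1 tD) mulVKf// subrK.
apply: (ae_imp _ (aeI hm mc)) => t [h1 h2] tD.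
by rewrite (h1 tD) (h2 tD) addrK mulKf.
Qed.

Lemma dual_functionalE w : S2 w -> dual_functional T c0 V g rho Q w = reduced_dual w.
Proof.
move=> hw; rewrite /dual_functional /reduced_dual; congr (_ - _).
by apply: eq_Rintegral => x _; rewrite value_phi.
Qed.

Lemma equilibrium_iff w : S2 w ->
  equilibrium_price T c0 V g rho Q w <->
  minimizes_over_L2 T (dual_functional T c0 V g rho Q) w.
Proof.
move=> hw; split.
  move=> [Lw [z [zmin _] mc]]; split; first exact: Lw.
  move=> eta /S2_L2 he.
  have hex x : exists v, minimal w x v /\ {in `[0, T], z ^~ x =1 traj x v}.
    by have [_ [v hv zv]] := (minimizerP x (z ^~ x) hw).1 (zmin x); exists v.
  have [v hv] := choice hex.
  have hmin x : minimal w x (v x) by case: (hv x).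
  have hz x : {in `[0, T], z ^~ x =1 traj x (v x)} by case: (hv x).
  rewrite (dual_functionalE hw) (dual_functionalE he); apply: (reduced_clearing_min hw he hmin).
  exact/(market_clearingP hw hmin hz).
move=> [Lw wmin]; split; first exact: Lw.
(* Any choice of minimizers will do, since [traj_jointly_measurable] makes it a measurable
   selection. *)
have [v hv] := choice (fun x => minimal_exists x hw).
have hz (x : R) : {in `[0, T], (fun t => traj x (v x) t) =1 traj x (v x)} by [].
exists (fun t x => traj x (v x) t).
  split; last exact: measurable_funTS (traj_jointly_measurable hw hv).
  move=> x; apply/(minimizerP _ _ hw); have [Sv _] := hv x.
  by split; [exact: (traj_H1 x Sv).1|exists (v x)].
apply/(market_clearingP hw hv hz); apply: (reduced_min_clearing hw hv) => eta he.
by rewrite -(dual_functionalE hw) -(dual_functionalE he); apply: wmin; exact/S2_L2.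
Qed.

End population.

End reduced_problem.

Unset Implicit Arguments.

Theorem theorem3p2 (R : realType) (T c0 : R) (V g rho0 Q omega : R -> R)
  (hT : 0 < T) (hc0 : 0 < c0)
  (hV : bounded_derivatives V) (hg : bounded_derivatives g)
  (hrho0 : probability_density rho0) (hsupp : compactly_supported rho0)
  (hQ : L2 T Q) (homega : L2 T omega) :
  equilibrium_price T c0 V g rho0 Q omega <->
  minimizes_over_L2 T (dual_functional T c0 V g rho0 Q) omega.
Proof.
have [B1 [B10 V1 V2 V3 V4]] := bounded_derivatives_bound hV.
have [B2 [B20 g1 g2 g3 g4]] := bounded_derivatives_bound hg.
have [mrho rho_ge0 rho1] := hrho0.
(* A single constant, B1 + B2, has to serve for both V and g. *)
have w1 (r : R) : 0 <= r -> B1 * r <= (B1 + B2) * r.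
  by move=> r0; rewrite ler_wpM2r// lerDl ltW.
have w2 (r : R) : 0 <= r -> B2 * r <= (B1 + B2) * r.
  by move=> r0; rewrite ler_wpM2r// lerDr ltW.
apply: (@equilibrium_iff R T c0 (B1 + B2) V (derive1 V) g (derive1 g)) => //.
- exact: addr_gt0.
- by move=> z; rewrite (le_trans (V1 z))// lerDl ltW.
- by move=> z; rewrite (le_trans (g1 z))// lerDr ltW.
- by move=> y z; rewrite (le_trans (V2 y z))// w1.
- by move=> y z; rewrite (le_trans (g2 y z))// w2.
- by move=> y z; rewrite (le_trans (V3 y z))// w1.
- by move=> y z; rewrite (le_trans (g3 y z))// w2.
- by move=> y z; rewrite (le_trans (V4 y z))// w1// sqr_ge0.
- by move=> y z; rewrite (le_trans (g4 y z))// w2// sqr_ge0.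
- exact/S2_L2.
- exact/S2_L2.
Qed.
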